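(* Let $S$ and $\bar S$ be $(\rho,\eta)$-sprays of the mechanical $(\rho,\eta)$-systems $((E,\pi,M),F_e,(\rho,\eta)\Gamma)$ and $((E,\pi,M),\bar F_e,(\rho,\eta)\bar\Gamma)$, respectively, both relative to the same locally invertible vector bundle morphism $(g,h)$. Then $S$ and $\bar S$ are projectively related if and only if the geodesics of these systems with respect to the $(\rho,\eta)$-sprays $S$ and $\bar S$ differ only in a strictly increasing parameter transformation.
   Context: Setting. $M$ is a smooth $m$-manifold, $(E,\pi,M)$ a smooth real vector bundle of rank $r$, $h,\eta:M\to M$ diffeomorphisms, and $((E,\pi,M),[\,,]_{E,h},(\rho,\eta))$ is a generalized Lie algebroid: $(\rho,\eta)$ is a vector bundle morphism from $(E,\pi,M)$ to $(TM,\tau_M,M)$ covering $\eta$, and $[\,,]_{E,h}$ is a Lie bracket on $\Gamma(E,\pi,M)$ with $[u,fv]_{E,h}=f[u,v]_{E,h}+(\Gamma(Th\circ\rho,h\circ\eta)(u)f)\,v$, where $\Gamma(Th\circ\rho,h\circ\eta)(u)$ is the vector field $Th\circ\rho\circ u\circ(h\circ\eta)^{-1}$ on $M$. The summation convention is used. In a vector bundle chart with coordinates $(x^i,y^a)$ on $E$ and local frame $(s_a)$, $[s_a,s_b]_{E,h}=L^c_{ab}s_c$, $\rho^i_a$ are the components of $\rho$ ($\rho(s_a)=\rho_a^i\,\partial/\partial x^i$), $\partial_i=\partial/\partial x^i$ and $\dot\partial_a=\partial/\partial y^a$ on $E$. Generalized tangent bundle. $(\rho,\eta)TE$ is the rank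 $2r$ vector subbundle of $(h\circ\pi)^*E\oplus TE$ over $E$ with local frame (natural base) $\tilde\partial_a=S_a\oplus(\rho^i_a\circ h\circ\pi)\partial_i$, $\dot{\tilde\partial}_a=0\oplus\dot\partial_a$, where $(S_a)$ is the frame of $(h\circ\pi)^*E$ induced by $(s_a)$. It is a Lie algebroid over $E$ with anchor $\tilde\rho(\tilde\partial_a)=(\rho^i_a\circ h\circ\pi)\partial_i$, $\tilde\rho(\dot{\tilde\partial}_a)=\dot\partial_a$, and bracket determined by the Leibniz rule and $[\tilde\partial_a,\tilde\partial_b]=(L^c_{ab}\circ h\circ\pi)\tilde\partial_c$, $[\tilde\partial_a,\dot{\tilde\partial}_b]=0$, $[\dot{\tilde\partial}_a,\dot{\tilde\partial}_b]=0$. The vertical subbundle is spanned by the $\dot{\tilde\partial}_a$. A $(\rho,\eta)$-connection $(\rho,\eta)\Gamma$ for $E$ is a left splitting of the inclusion of the vertical subbundle into $(\rho,\eta)TE$. $(g,h)$ is a locally invertible vector bundle morphism of $E$ covering $h$: it has local components $g^a_b$, and there are local functions $\tilde g^a_b$ on $M$ with $\tilde g^b_cg^c_a=\delta^b_a$. $\mathcal J_{(g,h)}$ is the endomorphism of $\Gamma((\rho,\eta)TE)$ with $\mathcal J_{(g,h)}(\tilde\partial_a)=(\tilde g^b_a\circ h\circ\pi)\dot{\tilde\partial}_b$, $\mathcal J_{(g,h)}(\dot{\tilde\partial}_a)=0$. Sprays. $U^a$ is the local function on $E$ with $U^a(u_x)=y^a$, and $\mathbb C=U^a\dot{\tilde\partial}_a$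 is the Liouville section. A mechanical $(\rho,\eta)$-system is a triple $((E,\pi,M),F_e,(\rho,\eta)\Gamma)$ with $F_e=F^a\dot{\tilde\partial}_a$ a vertical section (external force) and $(\rho,\eta)\Gamma$ a $(\rho,\eta)$-connection. A $(\rho,\eta)$-semispray of it (relative to $(g,h)$) is a section $S$ with $\mathcal J_{(g,h)}(S)=\mathbb C$, written locally as $S=(g^a_b\circ h\circ\pi)U^b\tilde\partial_a-2(G^a-\frac14F^a)\dot{\tilde\partial}_a$ with local functions $G^a$; likewise $\bar S=(g^a_b\circ h\circ\pi)U^b\tilde\partial_a-2(\bar G^a-\frac14\bar F^a)\dot{\tilde\partial}_a$. A semispray $S$ is a $(\rho,\eta)$-spray if $S\circ0$ is of class $C^1$ ($0$ the null section of $E$) and $[\mathbb C,S]_{(\rho,\eta)TE}-S=0$. A function $f$ on $E$ is 1-homogeneous if $U^a\dot\partial_af=f$. Two $(\rho,\eta)$-sprays $S,\bar S$ are projectively related if there is a 1-homogeneous function $f$ of class $C^1$ on $E$ with $\bar S=S+f\mathbb C$. Geodesics. Let $c:I\to M$ be a differentiable curve and $\dot c(t)=y^a(t)s_a((\eta\circ h\circ c)(t))$ a curve in $E$ over $\eta\circ h\circ c$. It is a $(g,h)$-lift of $c$ if $\rho^i_b(\eta\circ h\circ c(t))\,g^b_a(h\circ c(t))\,y^a(t)=\frac{d(\eta\circ h\circ c)^i(t)}{dt}$ for all $i$. The curve $c$ (with its $(g,h)$-lift $\dot c$) is a geodesic of the mechanical system with respect to $S$ if in addition $\frac{dy^a}{dt}+2(G^a-\frac14F^a)(\dot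 c(t))=0$ for all $a$ (and analogously for $\bar S$ with $\bar G^a-\frac14\bar F^a$). ''Differ only in a strictly increasing parameter transformation'' means: for every geodesic $c$, with lift $\dot c$, with respect to one of the sprays there is a smooth strictly increasing change of parameter $t\mapsto s(t)$ with $ds/dt>0$ such that $c$ reparametrized by $s$, with the correspondingly reparametrized lift (the lifts being related by $\dot c(t)=\dot c(s(t))\frac{ds}{dt}$), is a geodesic with respect to the other spray. *)

(* Defs.v *)
From HB Require Import structures.
From mathcomp Require Import all_boot all_order all_algebra.
From mathcomp Require Import all_classical all_reals all_analysis.
Set Implicit Arguments.
Unset Strict Implicit.
Unset Printing Implicit Defensive.
Import Order.TTheory GRing.Theory Num.Theory.
Import numFieldNormedType.Exports.
Local Open Scope classical_set_scope.
Local Open Scope ring_scope.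

(* [f] is of class C^k on the set [O], which is always open below. *)
Fixpoint Ck (R : realType) (n k : nat) (O : set 'rV[R]_n)
    (f : 'rV[R]_n -> R^o) : Prop :=
  match k with
  | 0 => forall z, O z -> {for z, continuous f}
  | k'.+1 => (forall z, O z -> differentiable f z) /\
             forall i : 'I_n, Ck k' O (fun z => 'D_(delta_mx 0 i) f z)
  end.

(* Charts are total functions, meaningful only on [cdom].  The carrier is a
   bare type: the definitions down to [pd] serve both for a manifold and for
   the total space of a vector bundle. *)
Record chart (R : realType) (T : Type) (n : nat) := Chart {
  cdom : set T;
  cmap : T -> 'rV[R]_n;
  cinv : 'rV[R]_n -> T }.

Section NearPoint.
Context {R : realType} {T : Type} {n : nat}.
Implicit Types (A : set (chart R T n)) (p : T) (f : T -> R^o).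

Definition Ck_near A (k : nat) p f : Prop :=
  forall c, A c -> cdom c p ->
    exists O : set 'rV[R]_n,
      [/\ open O, O (cmap c p) & Ck k O (fun z => f (cinv c z))].

Definition smooth_near A p f : Prop :=
  forall c, A c -> cdom c p ->
    exists O : set 'rV[R]_n,
      [/\ open O, O (cmap c p) & forall k, Ck k O (fun z => f (cinv c z))].

(* The coordinate vector d/dx^i at [p], as a functional.  It is set to 0 on
   functions that are not C^1 near [p], so that two tangent vectors (linear
   combinations of coordinate vectors) are equal as functionals as soon as they
   agree on the germs of C^1 functions. *)
Definition pd A (c : chart R T n) p (i : 'I_n) : (T -> R^o) -> R^o :=
  fun f => if `[< Ck_near A 1 p f >]
           then 'D_(delta_mx 0 i) (fun z => f (cinv c z) : R^o) (cmap c p)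
           else 0.

Definition tangent_at A p (D : (T -> R^o) -> R^o) : Prop :=
  forall c, A c -> cdom c p ->
    exists xi : 'rV[R]_n, D = \sum_(i < n) xi 0 i *: pd A c p i.

End NearPoint.

Definition chart_homeo (R : realType) (T : topologicalType) (n : nat)
    (c : chart R T n) : Prop :=
  [/\ open (cdom c),
      open (cmap c @` cdom c),
      forall p, cdom c p -> cinv c (cmap c p) = p,
      forall p, cdom c p -> {for p, continuous (cmap c)} &
      forall z, (cmap c @` cdom c) z -> {for z, continuous (cinv c)}].

Record manifold (R : realType) (m : nat) := Manifold {
  mpoints :> topologicalType;
  charts : set (chart R mpoints m);
  m_hausdorff : hausdorff_space mpoints;
  m_second_countable : @second_countable mpoints;
  charts_cover : forall p, exists2 c, charts c & cdom c p;
  charts_homeo : forall c, charts c -> chart_homeo c;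
  charts_compat : forall c, charts c -> forall p, cdom c p ->
    forall i, smooth_near charts p (fun q => cmap c q 0 i) }.
Arguments charts {R m} _.

Definition smooth_fun (R : realType) (m : nat) (M : manifold R m)
    (f : M -> R^o) : Prop :=
  forall p, smooth_near (charts M) p f.

Definition smooth_map (R : realType) (m : nat) (M : manifold R m)
    (F : M -> M) : Prop :=
  forall p, {for p, continuous F} /\
    forall c, charts M c -> cdom c (F p) ->
      forall i, smooth_near (charts M) p (fun q => cmap c (F q) 0 i).

Record diffeo (R : realType) (m : nat) (M : manifold R m) := Diffeo {
  diffeo_fun :> M -> M;
  diffeo_inv : M -> M;
  diffeo_funK : cancel diffeo_fun diffeo_inv;
  diffeo_invK : cancel diffeo_inv diffeo_fun;
  diffeo_smooth : smooth_map diffeo_fun;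
  diffeo_inv_smooth : smooth_map diffeo_inv }.

(* A local frame, with [fco s u] the components of [u : F x] in it. *)
Record frame (R : realType) (T : Type) (F : T -> lmodType R) (r : nat) :=
  Frame {
    fdom : set T;
    fvec : 'I_r -> forall x, F x;
    fco : forall x, F x -> 'rV[R]_r }.

Definition is_frame (R : realType) (T : topologicalType) (F : T -> lmodType R)
    (r : nat) (s : frame F r) : Prop :=
  open (fdom s) /\
  forall x, fdom s x ->
    (forall u : F x, u = \sum_(a < r) fco s u 0 a *: fvec s a x) /\
    (forall y : 'rV[R]_r, fco s (\sum_(a < r) y 0 a *: fvec s a x) = y).

(* A vector bundle is given by its fibres and by a family of local frames with
   smooth transition functions; its total space [tot] below then has the
   bundle charts [bundle_chart c s] as smooth atlas. *)
Record vbundle (R : realType) (m : nat) (M : manifold R m) (r : nat) :=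
  VBundle {
    fibre :> M -> lmodType R;
    frames : set (frame fibre r);
    frames_cover : forall x, exists2 s, frames s & fdom s x;
    frames_frame : forall s, frames s -> is_frame s;
    frames_compat : forall s s', frames s -> frames s' ->
      forall x, fdom s x -> fdom s' x -> forall a b : 'I_r,
        smooth_near (charts M) x (fun q => fco s' (fvec s a q) 0 b) }.
Arguments frames {R m M r} _.

Section Bundle.
Context {R : realType} {m : nat} {M : manifold R m} {r : nat}.
Variable E : vbundle M r.

Definition tot : Type := {x : M & E x}.

Definition bundle_chart (c : chart R M m) (s : frame E r) :
    chart R tot (m + r) :=
  {| cdom := [set p : tot | cdom c (tag p) /\ fdom s (tag p)];
     cmap := fun p => row_mx (cmap c (tag p)) (fco s (tagged p));
     cinv := fun z => existT (fun x : M => E x : Type) (cinv c (lsubmx z))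
       (\sum_(a < r) rsubmx z 0 a *: fvec s a (cinv c (lsubmx z))) |}.

Definition tot_charts : set (chart R tot (m + r)) :=
  [set C | exists c s, [/\ charts M c, frames E s & C = bundle_chart c s]].

Definition smooth_sec (u : forall x, E x) : Prop :=
  forall s x, frames E s -> fdom s x ->
    forall a, smooth_near (charts M) x (fun q => fco s (u q) 0 a).

Definition tscale (k : R) (p : tot) : tot :=
  existT (fun x : M => E x : Type) (tag p) (k *: tagged p).

Definition tnull (x : M) : tot := existT (fun x : M => E x : Type) x 0.

(* The fibre coordinate y^a, also written U^a. *)
Definition ycoord (s : frame E r) (a : 'I_r) : tot -> R^o :=
  fun p => fco s (tagged p) 0 a.

End Bundle.
Arguments tnull {R m M r} E x.

Section GLA.
Context {R : realType} {m : nat} {M : manifold R m} {r : nat}.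
Variables (E : vbundle M r) (h eta : diffeo M).

(* [gl_anchor x] maps the fibre E_x to the tangent space of M at [eta x].
   The axioms of the bracket concern global smooth sections.  The bracket of
   such sections at a point depends only on their germs there; [gl_local]
   extends the bracket along germs to arbitrary dependent functions, so that
   the bracket of two members of a local frame makes sense on its domain. *)
Record gen_lie_algebroid := GenLieAlgebroid {
  gl_anchor : forall x, E x -> (M -> R^o) -> R^o;
  gl_anchor_tangent : forall x (u : E x),
    tangent_at (charts M) (eta x) (gl_anchor u);
  gl_anchor_linear : forall x (k : R) (u v : E x),
    gl_anchor (k *: u + v) = k *: gl_anchor u + gl_anchor v;
  gl_anchor_smooth : forall c s x, charts M c -> frames E s ->
    cdom c (eta x) -> fdom s x -> forall i a,
      smooth_near (charts M) x
        (fun q => gl_anchor (fvec s a q) (fun z => cmap c z 0 i));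
  gl_br : (forall x, E x) -> (forall x, E x) -> forall x, E x;
  gl_br_smooth : forall u v,
    smooth_sec u -> smooth_sec v -> smooth_sec (gl_br u v);
  gl_br_linear : forall (k : R) u v w,
    smooth_sec u -> smooth_sec v -> smooth_sec w -> forall x,
      gl_br (fun x => k *: u x + v x) w x = k *: gl_br u w x + gl_br v w x;
  gl_br_alt : forall u, smooth_sec u -> forall x, gl_br u u x = 0;
  gl_br_jacobi : forall u v w,
    smooth_sec u -> smooth_sec v -> smooth_sec w -> forall x,
      gl_br u (gl_br v w) x + gl_br v (gl_br w u) x + gl_br w (gl_br u v) x = 0;
  (* The vector field Th o rho o u o (h o eta)^-1 acts on [f] at [y] as
     rho (u x) acts on f o h, where x = (h o eta)^-1 y. *)
  gl_br_leibniz : forall u v (f : M -> R^o),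
    smooth_sec u -> smooth_sec v -> smooth_fun f -> forall y,
      gl_br u (fun x => f x *: v x) y =
        f y *: gl_br u v y +
        gl_anchor (u (diffeo_inv eta (diffeo_inv h y))) (fun z => f (h z)) *: v y;
  gl_local : forall u u' v v' y,
    (\forall q \near y, u q = u' q) -> (\forall q \near y, v q = v' q) ->
    gl_br u v y = gl_br u' v' y }.

Record inv_morphism := InvMorphism {
  im_fun :> forall x, {linear E x -> E (h x)};
  im_inv : forall x, {linear E (h x) -> E x};
  im_funK : forall x, cancel (im_fun x) (im_inv x);
  im_smooth : forall s s' x, frames E s -> frames E s' ->
    fdom s x -> fdom s' (h x) -> forall a b,
      smooth_near (charts M) x (fun q => fco s' (im_fun q (fvec s a q)) 0 b) }.

End GLA.

Section GTB.
Context {R : realType} {m : nat} {M : manifold R m} {r : nat}.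
Context {E : vbundle M r} {h eta : diffeo M}.
Variable A : gen_lie_algebroid E h eta.

(* The fibre at [p] of (h o pi)^*E (+) TE, with tangent vectors of the total
   space as functionals, like [pd]; the generalized tangent bundle is cut out of
   it by [in_gtb]. *)
Definition gtb (p : tot E) : lmodType R :=
  (E (h (tag p)) * ((tot E -> R^o) -> R^o))%type.

(* Local data around a point of E over x: a chart of M and a frame of E around
   x, which give the coordinates (x^i, y^a) on E, and a frame of E around h x,
   which gives the frame (S_a) of (h o pi)^*E.  (The points x and h x need not
   lie in the domain of one and the same frame.) *)
Record natchart := NatChart {
  nc_chart : chart R M m;
  nc_frame : frame E r;
  nc_hframe : frame E r }.

Definition adapted (k : natchart) (x : M) : Prop :=
  [/\ charts M (nc_chart k) /\ cdom (nc_chart k) x,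
      frames E (nc_frame k) /\ fdom (nc_frame k) x &
      frames E (nc_hframe k) /\ fdom (nc_hframe k) (h x)].

(* rho^i_a at h x.  The vector rho (s_a (h x)) is tangent at eta (h x); it can be
   nonzero only if h x is fixed by h o eta (see [gh_lift]), hence only if
   eta (h x) = x, so that a chart around x can be used. *)
Definition rho_co (k : natchart) (x : M) (i : 'I_m) (a : 'I_r) : R :=
  gl_anchor A (fvec (nc_hframe k) a (h x)) (fun z => cmap (nc_chart k) z 0 i).

(* L^c_{ab} at h x. *)
Definition L_co (k : natchart) (x : M) (a b c : 'I_r) : R :=
  fco (nc_hframe k)
    (gl_br A (fvec (nc_hframe k) a) (fvec (nc_hframe k) b) (h x)) 0 c.

Definition dx (k : natchart) (p : tot E) (i : 'I_m) : (tot E -> R^o) -> R^o :=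
  pd (@tot_charts R m M r E) (bundle_chart (nc_chart k) (nc_frame k)) p
     (lshift r i).

Definition dy (k : natchart) (p : tot E) (a : 'I_r) : (tot E -> R^o) -> R^o :=
  pd (@tot_charts R m M r E) (bundle_chart (nc_chart k) (nc_frame k)) p
     (rshift m a).

(* The natural base: [hbase] and [vbase] are the undotted and the dotted
   members. *)
Definition hbase (k : natchart) (p : tot E) (a : 'I_r) : gtb p :=
  (fvec (nc_hframe k) a (h (tag p)),
   \sum_(i < m) rho_co k (tag p) i a *: dx k p i).

Definition vbase (k : natchart) (p : tot E) (a : 'I_r) : gtb p :=
  (0, dy k p a).

(* Components in the natural base: [hco] reads the (h o pi)^*E part and [vco]
   applies the TE part to y^a, as d/dx^i kills y^a. *)
Definition hco (k : natchart) (p : tot E) (z : gtb p) (a : 'I_r) : R :=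
  fco (nc_hframe k) z.1 0 a.

Definition vco (k : natchart) (p : tot E) (z : gtb p) (a : 'I_r) : R :=
  z.2 (ycoord (nc_frame k) a).

Definition in_gtb (p : tot E) (z : gtb p) : Prop :=
  forall k, adapted k (tag p) ->
    z = \sum_(a < r) hco k z a *: hbase k p a
      + \sum_(a < r) vco k z a *: vbase k p a.

Definition vertical (p : tot E) (z : gtb p) : Prop :=
  forall k, adapted k (tag p) ->
    exists w : 'rV[R]_r, z = \sum_(a < r) w 0 a *: vbase k p a.

Definition gtb_section (Z : forall p, gtb p) : Prop :=
  (forall p, in_gtb (Z p)) /\
  forall k p, adapted k (tag p) -> forall a,
    smooth_near (@tot_charts R m M r E) p (fun q => hco k (Z q) a) /\
    smooth_near (@tot_charts R m M r E) p (fun q => vco k (Z q) a).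

(* Bracket of two sections at [p], in the natural base.  This is the expansion
   by the Leibniz rule of the bracket whose only nonzero values on the base are
   [hbase a, hbase b] = L^c_{ab} hbase c; the anchor is the second projection
   of [gtb]. *)
Definition gtb_br (k : natchart) (Z W : forall p, gtb p) (p : tot E) : gtb p :=
  \sum_(c < r)
     ((Z p).2 (fun q => hco k (W q) c) - (W p).2 (fun q => hco k (Z q) c)
      + \sum_(a < r) \sum_(b < r)
          L_co k (tag p) a b c * hco k (Z p) a * hco k (W p) b) *: hbase k p c
  + \sum_(c < r)
     ((Z p).2 (fun q => vco k (W q) c) - (W p).2 (fun q => vco k (Z q) c))
       *: vbase k p c.

Definition liouville (k : natchart) (p : tot E) : gtb p :=
  \sum_(a < r) ycoord (nc_frame k) a p *: vbase k p a.

Record gtb_connection := GtbConnection {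
  conn :> forall p, gtb p -> gtb p;
  conn_vertical : forall p (z : gtb p), in_gtb z -> vertical (conn z);
  conn_linear : forall p (l : R) (z w : gtb p), in_gtb z -> in_gtb w ->
    conn (l *: z + w) = l *: conn z + conn w;
  conn_smooth : forall Z, gtb_section Z -> gtb_section (fun p => conn (Z p));
  conn_split : forall p (z : gtb p), vertical z -> conn z = z }.

Record mech_system := MechSystem {
  force : forall p, gtb p;
  force_section : gtb_section force;
  force_vertical : forall p, vertical (force p);
  ms_conn : gtb_connection }.

Section Sprays.
Variable g : inv_morphism E h.

(* g^b_a and its inverse matrix at h x (a indexes the frame at x, b the frame
   at h x; the other way around for the inverse). *)
Definition g_co (k : natchart) (x : M) (b a : 'I_r) : R :=
  fco (nc_hframe k) (g x (fvec (nc_frame k) a x)) 0 b.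

Definition ginv_co (k : natchart) (x : M) (b a : 'I_r) : R :=
  fco (nc_frame k) (im_inv g x (fvec (nc_hframe k) a (h x))) 0 b.

Definition Jop (k : natchart) (Z : forall p, gtb p) (p : tot E) : gtb p :=
  \sum_(a < r) hco k (Z p) a *:
    \sum_(b < r) ginv_co k (tag p) b a *: vbase k p b.

Definition semispray (S : forall p, gtb p) : Prop :=
  gtb_section S /\
  forall k p, adapted k (tag p) -> Jop k S p = liouville k p.

(* The functions G^a of the local expression
   S = (g^a_b o h o pi) U^b hbase_a - 2 (G^a - F^a / 4) vbase_a.
   The external force enters the theory only through them: being a semispray
   or a spray is a condition on S alone. *)
Definition G_co (Sys : mech_system) (S : forall p, gtb p) (k : natchart)
    (p : tot E) (a : 'I_r) : R :=
  vco k (force Sys p) a / 4 - vco k (S p) a / 2.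

Definition spray (S : forall p, gtb p) : Prop :=
  [/\ semispray S,
      forall k x, adapted k x -> forall a,
        Ck_near (charts M) 1 x (fun q => hco k (S (tnull E q)) a) /\
        Ck_near (charts M) 1 x (fun q => vco k (S (tnull E q)) a) &
      forall k p, adapted k (tag p) -> gtb_br k (liouville k) S p - S p = 0].

Definition homogeneous1 (f : tot E -> R^o) : Prop :=
  forall k p, adapted k (tag p) ->
    \sum_(a < r) ycoord (nc_frame k) a p * dy k p a f = f p.

Definition projectively_related (S S' : forall p, gtb p) : Prop :=
  exists f : tot E -> R^o,
    [/\ forall p, Ck_near (@tot_charts R m M r E) 1 p f,
        homogeneous1 f &
        forall k p, adapted k (tag p) -> S' p = S p + f p *: liouville k p].

Definition over_curve (I : set R) (c : R -> M) (cd : R -> tot E) : Prop :=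
  forall t, I t -> tag (cd t) = eta (h (c t)).

Definition differentiable_curve (I : set R) (c : R -> M) : Prop :=
  forall t, I t -> {for t, continuous c} /\
    forall d, charts M d -> cdom d (c t) ->
      forall i, derivable (fun u => cmap d (c u) 0 i : R^o) t 1.

(* The products rho^i_b g^b_a are the components of rho o g on the fibre over
   eta (h (c t)), where [cd t] lies, indexed as in the local expression of a
   semispray: rho and the target frame of g are taken at h (eta (h (c t))).  The
   axioms of [gen_lie_algebroid] force rho to vanish away from the fixed points
   of h o eta; at those points eta (h (c t)) = c t, and this is
   rho^i_b g^b_a with g taken at h (c t) and rho^i_b at the point
   eta (h (c t)) of its target. *)
Definition gh_lift (I : set R) (c : R -> M) (cd : R -> tot E) : Prop :=
  forall t, I t -> forall k, adapted k (eta (h (c t))) -> forall i,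
    let xi := fun u => cmap (nc_chart k) (eta (h (c u))) 0 i : R^o in
    derivable xi t 1 /\
    \sum_(b < r) \sum_(a < r)
      rho_co k (eta (h (c t))) i b * g_co k (eta (h (c t))) b a
        * ycoord (nc_frame k) a (cd t) = derive1 xi t.

Definition geodesic (Sys : mech_system) (S : forall p, gtb p)
    (I : set R) (c : R -> M) (cd : R -> tot E) : Prop :=
  [/\ open I /\ is_interval I,
      differentiable_curve I c,
      over_curve I c cd,
      gh_lift I c cd &
      forall t, I t -> forall k, adapted k (tag (cd t)) -> forall a,
        let ya := fun u => ycoord (nc_frame k) a (cd u) : R^o in
        derivable ya t 1 /\
        derive1 ya t
          + 2 * (G_co Sys S k (cd t) a - vco k (force Sys (cd t)) a / 4) = 0].

Definition param_change (I : set R) (s : R -> R^o) : Prop :=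
  [/\ forall n t, I t -> derivable (derive1n n s : R -> R^o) t 1,
      forall t, I t -> 0 < derive1 s t &
      {in I &, forall t u, t < u -> s t < s u}].

Definition geodesics_reparam (Sys : mech_system) (S : forall p, gtb p)
    (Sys' : mech_system) (S' : forall p, gtb p) : Prop :=
  forall I c cd, geodesic Sys S I c cd ->
    exists (s : R -> R^o) (c' : R -> M) (cd' : R -> tot E),
      [/\ param_change I s,
          geodesic Sys' S' (s @` I) c' cd' &
          forall t, I t ->
            c t = c' (s t) /\ cd t = tscale (derive1 s t) (cd' (s t))].

Definition geodesics_differ_by_param (Sys : mech_system)
    (S : forall p, gtb p) (Sys' : mech_system) (S' : forall p, gtb p) : Prop :=
  geodesics_reparam Sys S Sys' S' /\ geodesics_reparam Sys' S' Sys S.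

End Sprays.
End GTB.
Arguments gtb {R m M r E} h p.

(* Main.v *)
(** Write [y^a] for the fibre coordinates and [V^a], [V'^a] for the vertical
    components of [S], [S'].  A curve with its lift is a geodesic of [S] exactly
    when the lift is an integral curve of the vector field [(S p).2] on [E]; in
    particular [dy^a/dt = V^a].  The spray condition is Euler's identity, so
    [V^a] is 2-homogeneous in the fibres.

    If [S' = S + f C], a reparametrization [s] turns geodesics of [S] into
    geodesics of [S'] when [s'' = - f s'] along the lift, which is solved by
    [s' = exp (- int f)].  Here [f] is a priori only C^1, but
    [V'^a - V^a = f y^a] and Euler's identity for [f] give
    [f = div (V' - V) / (r + 1)] (fibre divergence), so [f] and hence [s] are
    smooth.

    Conversely, through every point of [E] there is a geodesic of [S] (Picard),
    and comparing it with its reparametrization shows that [V' - V] is a multiple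
    [f y] of [y] at that point.  The same divergence formula shows that [f] is
    smooth, including along the null section.

    For both directions the components of the anchor have to be smooth in the
    coordinates of [M], although they mix the points [x] and [h (eta x)]: the
    Leibniz rule, applied to sections cut off by bump functions, shows that the
    anchor vanishes at every point not fixed by [h o eta]. *)

(* The condition [J S = C] fixes the horizontal components through [g] and [y], so two semisprays
   relative to the same [g] differ only vertically and everything is decided by [V' - V].

   Comparing geodesics yields one scalar at each point of [E], chosen independently from point to
   point, so the resulting factor has no regularity of its own. Dividing [V'^a - V^a] by [y^a]
   recovers it smoothly only where [y^a <> 0]. The divergence formula contains no division by [y],
   which is why it also reaches the null section. There [V' - V = f y] leaves [f] undetermined; the
   value 0 is the right one, because the divergence of a 2-homogeneous field vanishes at [y = 0].

   Geodesics must satisfy their equations in every adapted chart, whereas the differential equation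
   is solved in a single one. The functional [(S p).2], which is independent of charts, carries the
   equations from one chart to the others. *)
Require Import Defs.
From HB Require Import structures.
From mathcomp Require Import all_boot all_order all_algebra.
From mathcomp Require Import all_classical all_reals all_analysis.
From mathcomp Require Import ring lra.
Set Implicit Arguments.
Unset Strict Implicit.
Unset Printing Implicit Defensive.
Import Order.TTheory GRing.Theory Num.Theory.
Import numFieldNormedType.Exports.
Local Open Scope classical_set_scope.
Local Open Scope ring_scope.

(** * Functions of class C^k *)

Section Calculus.
Context {R : realType}.

Lemma differentiable_rV n (V : normedModType R) (G : V -> 'rV[R]_n) x :
  (forall j, differentiable (fun y => G y 0 j : R^o) x) -> differentiable G x.
Proof.
move=> dG.
have -> : G = \sum_(j < n) (fun y => (G y 0 j : R^o) *: (delta_mx 0 j : 'rV[R]_n)).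
  by apply/funext => y; rewrite fct_sumE [LHS]row_sum_delta.
apply: differentiable_sum => j.
exact: (@differentiableZl _ _ _ (fun y => G y 0 j) _ _ (dG j)).
Qed.

Lemma derive_partials n (F : 'rV[R]_n -> R^o) z v : differentiable F z ->
  'D_v F z = \sum_(j < n) v 0 j * 'D_(delta_mx 0 j) F z.
Proof.
move=> dF; rewrite deriveE// {1}[v]row_sum_delta linear_sum.
by apply: eq_bigr => j _; rewrite linearZ deriveE.
Qed.

Lemma chain_rule n (V : normedModType R) (F : 'rV[R]_n -> R^o)
    (G : V -> 'rV[R]_n) x :
  (forall j, differentiable (fun y => G y 0 j : R^o) x) ->
  differentiable F (G x) ->
  differentiable (F \o G) x /\
  forall v, 'D_v (F \o G) x =
    \sum_(j < n) 'D_v (fun y => G y 0 j : R^o) x * 'D_(delta_mx 0 j) F (G x).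
Proof.
move=> dG dF; have dGx := differentiable_rV dG.
have dFG : differentiable (F \o G) x by exact: differentiable_comp.
split=> // v; rewrite deriveE// diff_comp//= -deriveE// -deriveE//.
rewrite derive_partials//; apply: eq_bigr => j _; congr (_ * _).
by rewrite derive_mx ?mxE//; exact: diff_derivable.
Qed.

Lemma chain_curve n (F : 'rV[R]_n -> R^o) (z : R -> 'rV[R]_n) (t : R) (w : 'I_n -> R) :
  (forall j, is_derive t 1 (fun u => z u 0 j : R^o) (w j)) ->
  differentiable F (z t) ->
  is_derive t 1 (fun u => F (z u) : R^o)
    (\sum_(j < n) w j * 'D_(delta_mx 0 j) F (z t)).
Proof.
move=> dz dF.
have dz' j : differentiable (fun u => z u 0 j : R^o) t.
  by apply/derivable1_diffP; case: (dz j).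
have [dFz Fz] := chain_rule dz' dF.
apply: DeriveDef; first exact/derivable1_diffP.
rewrite -[fun u => _]/(F \o z) Fz; apply: eq_bigr => j _.
by case: (dz j) => _ ->.
Qed.

(** Differentiability speaks of the differential ['d] at the point, so it passes to functions with
    the same germ only through uniqueness of the first-order expansion. The difference of two such
    functions has the zero germ, which is the case treated here. *)
Lemma near0_differentiable (V W : normedModType R) (e : V -> W) z :
  (\forall y \near z, e y = 0) -> differentiable e z.
Proof.
move=> e0.
(* The zero map, obtained as the differential of a constant so that it comes with its linear
   structure. *)
pose L : {linear V -> W} := 'd (cst 0 : V -> W) z.
have L0 : L = 0 :> (V -> W) by exact: diff_cst.
have c0 : continuous L by rewrite L0; exact: cst_continuous.
have E : e \o shift z = cst (e z) + L +o_ (0 : V) id.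
  rewrite L0; apply/eqaddoP => eps eps0.
  have := e0; rewrite (near_shift 0); apply: filterS => h /=; rewrite subr0 => eh.
  rewrite /= !fctE /= eh (nbhs_singleton e0) addr0 subr0 normr0.
  by rewrite mulr_ge0// ltW.
by apply/diff_locallyP; rewrite (diff_unique c0 E).
Qed.

Lemma near_eq_differentiable (V W : normedModType R) (f g : V -> W) z :
  (\forall y \near z, f y = g y) -> differentiable f z -> differentiable g z.
Proof.
move=> fg df; have -> : g = f + (g - f) by rewrite addrC subrK.
apply: differentiableD; first exact: df.
apply: near0_differentiable; apply: filterS fg => y e.
by rewrite /GRing.add/= /GRing.opp/= e addrN.
Qed.

Lemma open_near_eq (T : topologicalType) (U : Type) (O : set T) (f g : T -> U) z :
  open O -> O z -> (forall y, O y -> f y = g y) -> \forall y \near z, f y = g y.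
Proof. by move=> oO Oz fg; apply: filterS (open_nbhs_nbhs (conj oO Oz)). Qed.

Lemma near_eq_continuous (T U : topologicalType) (f g : T -> U) z :
  (\forall y \near z, f y = g y) -> {for z, continuous f} ->
  {for z, continuous g}.
Proof.
move=> fg cf; rewrite /prop_for /continuous_at -(nbhs_singleton fg).
exact: cvg_trans (near_eq_cvg fg) cf.
Qed.

Section CkTheory.
Variable n : nat.
Implicit Types (k : nat) (O : set 'rV[R]_n) (f g : 'rV[R]_n -> R^o).

Lemma Ck_ext k O f g : open O ->
  (forall z, O z -> f z = g z) -> Ck k O f -> Ck k O g.
Proof.
move=> oO; elim: k f g => [|k IH] f g fg /=.
  move=> cf z Oz; exact: near_eq_continuous (open_near_eq oO Oz fg) (cf z Oz).
move=> [df Df]; split => [z Oz|i].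
  exact: near_eq_differentiable (open_near_eq oO Oz fg) (df z Oz).
apply: IH (Df i) => z Oz; apply: near_eq_derive; exact: (open_near_eq oO Oz).
Qed.

Lemma Ck_sub k O O' f : O' `<=` O -> Ck k O f -> Ck k O' f.
Proof.
move=> OO; elim: k f => [|k IH] f /= => [cf z /OO|[df Df]]; first exact: cf.
by split=> [z /OO|i]; [exact: df|exact: IH].
Qed.

(** At every order [Ck] is a condition at single points, so it is local. *)
Lemma Ck_glue k (A : set 'rV[R]_n) f :
  (forall z, A z -> exists O, [/\ open O, O z & Ck k O f]) -> Ck k A f.
Proof.
elim: k f => [|k IH] f H.
  by move=> z /H [U [_ Uz cf]]; exact: cf.
split=> [z /H [U [_ Uz [df _]]]|i]; first exact: df.
by apply: IH => z /H [U [oU Uz [_ Df]]]; exists U; split=> //; exact: Df.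
Qed.

Lemma Ck_pred k O f : Ck k.+1 O f -> Ck k O f.
Proof.
elim: k f => [|k IH] f [df Df].
  by move=> z Oz; exact/differentiable_continuous/df.
by split=> // i; exact: IH.
Qed.

Lemma Ck_cst k O (a : R) : Ck k O (fun=> a).
Proof.
elim: k a => [|k IH] a; first by move=> z _; exact: cst_continuous.
split=> [z _|i]; first exact: differentiable_cst.
rewrite (_ : (fun z => 'D_(delta_mx 0 i) (fun=> a : R^o) z) = fun=> 0)//.
by apply/funext => z; exact: derive_cst.
Qed.

Lemma derive_coord (z v : 'rV[R]_n) j :
  'D_v (fun y : 'rV[R]_n => y 0 j : R^o) z = v 0 j.
Proof.
by rewrite -[in RHS](derive_id z v) derive_mx ?mxE//; exact: derivable_id.
Qed.

Lemma Ck_coord k O j : Ck k O (fun z => z 0 j).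
Proof.
case: k => [|k]; first by move=> z _; exact: coord_continuous.
split=> [z _|i]; first exact: differentiable_coord.
rewrite (_ : (fun z => 'D_(delta_mx 0 i) (fun z : 'rV[R]_n => z 0 j : R^o) z) =
  fun=> (delta_mx 0 i : 'rV[R]_n) 0 j); first exact: Ck_cst.
by apply/funext => z; exact: derive_coord.
Qed.

Lemma Ck_add k O f g : open O -> Ck k O f -> Ck k O g ->
  Ck k O (fun z => f z + g z).
Proof.
move=> oO; elim: k f g => [|k IH] f g /=.
  by move=> cf cg z Oz; apply: (continuousD (cf z Oz) (cg z Oz)).
move=> [df Df] [dg Dg]; split=> [z Oz|i].
  exact: (differentiableD (df z Oz) (dg z Oz)).
apply: Ck_ext (IH _ _ (Df i) (Dg i)) => // z Oz.
by rewrite [RHS]deriveD//; apply: diff_derivable; [exact: df|exact: dg].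
Qed.

Lemma Ck_mul k O f g : open O -> Ck k O f -> Ck k O g ->
  Ck k O (fun z => f z * g z).
Proof.
move=> oO; elim: k f g => [|k IH] f g.
  by move=> cf cg z Oz; apply: (continuousM (cf z Oz) (cg z Oz)).
move=> Cf Cg; move: (Cf) (Cg) => [df Df] [dg Dg]; split=> [z Oz|i].
  exact: (differentiableM (df z Oz) (dg z Oz)).
have := Ck_add oO (IH _ _ (Ck_pred Cf) (Dg i)) (IH _ _ (Ck_pred Cg) (Df i)).
apply: Ck_ext => // z Oz.
by rewrite [RHS]deriveM//; apply: diff_derivable; [exact: df|exact: dg].
Qed.

Lemma Ck_scale k O (a : R) f : open O -> Ck k O f -> Ck k O (fun z => a * f z).
Proof. by move=> oO; apply: Ck_mul => //; exact: Ck_cst. Qed.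

Lemma Ck_sum k O (I : finType) (f : I -> 'rV[R]_n -> R^o) : open O ->
  (forall i, Ck k O (f i)) -> Ck k O (fun z => \sum_i f i z).
Proof.
move=> oO H; rewrite (_ : (fun z => \sum_i f i z) = \sum_i f i); last first.
  by apply/funext => z; rewrite fct_sumE.
by elim/big_ind : _ => //; [exact: Ck_cst|move=> ? ?; exact: Ck_add].
Qed.

End CkTheory.

Lemma continuous_rV n (T : topologicalType) (G : T -> 'rV[R]_n) z :
  (forall j, {for z, continuous (fun y => G y 0 j)}) -> {for z, continuous G}.
Proof.
move=> cG; apply/cvgrPdist_le => /= e e0; near=> y.
rewrite [leLHS]/Num.Def.normr/= mx_normrE (bigmax_le _ (ltW e0))//= => -[i j] _.
rewrite !mxE/= (ord1 i).
move: i j; near: y; apply: filter_forall => /= i; apply: filter_forall => j.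
exact: ((cvgrPdist_le _ _).1 (cG j)).
Unshelve. all: by end_near. Qed.

Lemma Ck_comp n p k (O : set 'rV[R]_n) (O' : set 'rV[R]_p)
    (F : 'rV[R]_n -> R^o) (G : 'rV[R]_p -> 'rV[R]_n) : open O' ->
  (forall z, O' z -> O (G z)) -> Ck k O F ->
  (forall j, Ck k O' (fun z => G z 0 j)) -> Ck k O' (fun z => F (G z)).
Proof.
move=> oO' GO; elim: k F => [|k IH] F.
  move=> cF cG z Oz; apply: continuous_comp (cF _ (GO _ Oz)).
  by apply: continuous_rV => j; exact: cG.
move=> [dF DF] CG; have dG z (Oz : O' z) j := (CG j).1 z Oz.
split=> [z Oz|i].
  exact: (chain_rule (dG z Oz) (dF _ (GO _ Oz))).1.
have := @Ck_sum _ k O' _ (fun j z => 'D_(delta_mx 0 i) (fun y => G y 0 j : R^o) z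
    * 'D_(delta_mx 0 j) F (G z)) oO'.
have H j : Ck k O' (fun z => 'D_(delta_mx 0 i) (fun y => G y 0 j : R^o) z
    * 'D_(delta_mx 0 j) F (G z)).
  apply: Ck_mul => //; first exact: (CG j).2.
  by apply: IH (DF j) _ => l; exact/Ck_pred/CG.
move=> /(_ H); apply: Ck_ext => // z Oz.
by rewrite [RHS](chain_rule (dG z Oz) (dF _ (GO _ Oz))).2.
Qed.

End Calculus.

(** * Primitives and ordinary differential equations *)

Section Primitive.
Context {R : realType}.
Local Notation mu := (@lebesgue_measure R).

Lemma Rintegral_itv_split (f : R -> R) (a b c : R) : a <= b -> b <= c ->
  mu.-integrable `[a, c] (EFin \o f) ->
  \int[mu]_(x in `[a, c]) f x - \int[mu]_(x in `[a, b]) f x =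
  \int[mu]_(x in `[b, c]) f x.
Proof.
move=> ab bc fi; rewrite Rintegral_itvB ?bnd_simp//.
rewrite Rintegral_itv_obnd_cbnd//.
apply: integrableS fi => //; by apply: subset_itvr; rewrite bnd_simp.
Qed.

Lemma Rintegral_itv_rev (f : R -> R) (a b : R) : a <= b ->
  \int[mu]_(x in `[b, a]) f x = 0.
Proof.
rewrite le_eqVlt => /predU1P[->|ab]; first by rewrite set_itv1 Rintegral_set1.
by rewrite set_itv_ge ?Rintegral_set0// bnd_simp -ltNge.
Qed.

Lemma open_itv_around (I : set R) (t u : R) : open I -> is_interval I ->
  I t -> I u -> exists a b, [/\ a < t, a < u, t < b, u < b & `[a, b] `<=` I].
Proof.
move=> oI iI It Iu.
wlog tu : t u It Iu / t <= u.
  move=> H; have [|/ltW] := leP t u; first exact: H.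
  by move=> /(H u t Iu It)[a [b [*]]]; exists a, b.
have /nbhs_ballP[e /= e0 te] := open_nbhs_nbhs (conj oI It).
have /nbhs_ballP[d /= d0 ud] := open_nbhs_nbhs (conj oI Iu).
have Ia : I (t - e / 2) by apply: te; rewrite /ball/= opprB addrC subrK gtr0_norm; lra.
have Ib : I (u + d / 2) by apply: ud; rewrite /ball/= opprD addNKr normrN gtr0_norm; lra.
exists (t - e / 2), (u + d / 2); split; try lra.
by move=> x /=; rewrite in_itv/=; exact: (iI _ _ Ia Ib).
Qed.

Lemma primitive (I : set R) (f : R -> R) (t0 : R) : open I -> is_interval I ->
  I t0 -> (forall t, I t -> {for t, continuous f}) ->
  exists F : R -> R, F t0 = 0 /\ forall t : R, I t -> is_derive t 1 F (f t).
Proof.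
move=> oI iI It0 cf.
(* The oriented integral from [t0] to [t]: whichever side of [t0] the point [t] lies on, one of the
   two terms vanishes. *)
pose F t := \int[mu]_(x in `[t0, t]) f x - \int[mu]_(x in `[t, t0]) f x.
exists F; split=> [|t It]; first by rewrite /F subrr.
have [a [b [at0 at_ t0b tb abI]]] := open_itv_around oI iI It0 It.
have fi u : u <= b -> mu.-integrable `[a, u] (EFin \o f).
  move=> ub; apply: continuous_compact_integrable; first exact: segment_compact.
  apply: continuous_in_subspaceT => x /set_mem xau; apply: cf; apply: abI.
  by apply: subset_itvl xau; rewrite bnd_simp.
(* Near [t], [F] differs by a constant from the integral with fixed left end [a], to which the
   fundamental theorem applies. *)
have FE u : u \in `]a, b[ ->
    \int[mu]_(x in `[a, u]) f x - \int[mu]_(x in `[a, t0]) f x = F u.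
  rewrite in_itv/= => /andP[au ub]; rewrite /F.
  have [t0u|/ltW ut0] := leP t0 u.
    by rewrite (Rintegral_itv_rev f t0u) subr0 Rintegral_itv_split// ?(ltW at0)//;
      exact/fi/ltW.
  rewrite (Rintegral_itv_rev f ut0) sub0r -(@Rintegral_itv_split f a u t0) ?opprB//;
    [exact: ltW|exact/fi/ltW].
have [dG Gt] := continuous_FTC1_closed tb (fi _ (lexx b)) at_ (cf _ It).
pose G u := \int[mu]_(x in `[a, u]) f x.
have d1 : is_derive t (1:R) G (f t) by apply: DeriveDef; rewrite -?derive1E.
have := is_deriveB d1 (is_derive_cst (\int[mu]_(x in `[a, t0]) f x) t 1).
rewrite subr0; apply: near_eq_is_derive.
have : \forall u \near t, u \in `]a, b[ by apply: near_in_itvoo; rewrite in_itv/= at_.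
by apply: filterS => u /FE.
Qed.

End Primitive.

Section Lipschitz.
Context {R : realType}.

Lemma coord_le_norm n (z : 'rV[R]_n) j : `|z 0 j| <= `|z|.
Proof.
by rewrite [leRHS]/Num.Def.normr/= mx_normrE; exact: (le_bigmax _ _ (0, j)).
Qed.

Lemma rV_norm_le n (z : 'rV[R]_n) e : 0 <= e ->
  (forall j, `|z 0 j| <= e) -> `|z| <= e.
Proof.
move=> e0 ze; rewrite [leLHS]/Num.Def.normr/= mx_normrE bigmax_le// => -[i j] _.
by rewrite (ord1 i).
Qed.

Lemma is_derive_continuous (f : R -> R) (t d : R) : is_derive t 1 f d ->
  {for t, continuous f}.
Proof. by case=> /derivable1_diffP df _; exact: differentiable_continuous. Qed.

Lemma mvt_bound (f df : R -> R) (a b C : R) : a <= b ->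
  (forall t : R, a <= t <= b -> is_derive t 1 f (df t)) ->
  (forall t, a <= t <= b -> `|df t| <= C) -> `|f b - f a| <= C * (b - a).
Proof.
move=> ab dfE dfC.
have [||c cab ->] := @MVT_segment R f df a b ab.
- by move=> t /[!in_itv]/= /andP[at_ tb]; apply: dfE; rewrite !ltW.
- apply: continuous_in_subspaceT => t /set_mem/=; rewrite in_itv/= => tab.
  exact: is_derive_continuous (dfE t tab).
by rewrite normrM (ger0_norm (x := b - a)) ?subr_ge0// ler_wpM2r ?subr_ge0// dfC.
Qed.

Lemma is_derive_affine (a b t : R) : is_derive t 1 (fun u : R => a + u * b) b.
Proof.
have h := is_deriveD (is_derive_cst a t (1:R)) (is_deriveZ b (is_derive_id t (1:R))).
have -> : (fun u => a + u * b) = cst a + b \*: id.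
  by apply/funext => u; rewrite /= [u * b]mulrC.
by move: h; rewrite add0r [b *: 1]mulr1.
Qed.

(** By continuity the partial derivatives exceed their absolute values at [z0] by at most 1 on a
    small ball. The ball is convex, so the mean value theorem applies along the segment from [w] to
    [z]. *)
Lemma C1_locally_lipschitz n (O : set 'rV[R]_n) F z0 : open O -> O z0 ->
  Ck 1 O F -> exists e L, [/\ 0 < e, 0 <= L &
    forall z w, `|z - z0| < e -> `|w - z0| < e ->
      O z /\ `|F z - F w| <= L * `|z - w|].
Proof.
move=> oO Oz0 [dF DF].
have : \forall z \near z0, O z /\
    forall i, `|'D_(delta_mx 0 i) F z| <= `|'D_(delta_mx 0 i) F z0| + 1.
  apply: filterI; first exact: open_nbhs_nbhs.
  near=> z => i; move: i; near: z; apply: filter_forall => i.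
  have /cvgrPdist_le/(_ 1 ltr01) := DF i _ Oz0.
  apply: filterS => z H; rewrite -(subrK ('D_(delta_mx 0 i) F z0) ('D_(delta_mx 0 i) F z)).
  by rewrite addrC (le_trans (ler_normD _ _))// lerD2l distrC.
move=> /nbhs_ballP[e /= e0 H].
pose L := \sum_(i < n) (`|'D_(delta_mx 0 i) F z0| + 1).
exists e, L; split=> // [|z w ze we]; first by apply: sumr_ge0 => i _; rewrite addr_ge0.
have He y : `|y - z0| < e -> O y /\
    forall i, `|'D_(delta_mx 0 i) F y| <= `|'D_(delta_mx 0 i) F z0| + 1.
  by move=> ye; apply: H; rewrite mx_norm_ball /ball_/= distrC.
split; first by have [] := He z ze.
pose g (t : R) : 'rV[R]_n := w + t *: (z - w).
have ge t : 0 <= t <= 1 -> `|g t - z0| < e.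
  move=> /andP[t0 t1].
  have -> : g t - z0 = (1 - t) *: (w - z0) + t *: (z - z0).
    by apply/rowP => j; rewrite /g !mxE; ring.
  rewrite (le_lt_trans (ler_normD _ _))// !normrZ (ger0_norm t0) ger0_norm ?subr_ge0//.
  (* Strictness comes from the term with factor [t], hence the separate case [t = 0]. *)
  have [->|t0'] := eqVneq t 0; first by rewrite subr0 mul1r mul0r addr0.
  have tp : 0 < t by rewrite lt_neqAle eq_sym t0'.
  have : t * `|z - z0| < t * e by rewrite ltr_pM2l.
  have : (1 - t) * `|w - z0| <= (1 - t) * e by rewrite ler_wpM2l ?subr_ge0// ltW.
  lra.
have dg (t : R) j : is_derive t 1 (fun u => g u 0 j : R^o) ((z - w) 0 j).
  rewrite (_ : (fun u => g u 0 j) = fun u => w 0 j + u * (z - w) 0 j).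
    exact: is_derive_affine.
  by apply/funext => u; rewrite /g !mxE.
have := @mvt_bound (F \o g) (fun t => \sum_(j < n) (z - w) 0 j * 'D_(delta_mx 0 j) F (g t))
   0 1 (L * `|z - w|) ler01.
rewrite subr0 mulr1 /= /g scale1r scale0r addr0 addrCA subrr addr0; apply.
  move=> t /ge/He[Ogt _].
  exact: chain_curve (dg t) (dF _ Ogt).
move=> t /ge/He[_ Hb].
rewrite (le_trans (ler_norm_sum _ _ _))// /L mulr_suml ler_sum// => j _.
by rewrite normrM mulrC ler_pM// coord_le_norm.
Unshelve. all: by end_near. Qed.

Lemma lipschitz_continuous (V W : normedModType R) (f : V -> W) L : 0 <= L ->
  (forall x y, `|f x - f y| <= L * `|x - y|) -> continuous f.
Proof.
move=> L0 fL x; apply/cvgrPdist_le => /= e e0.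
have L1 : 0 < L + 1 by rewrite ltr_wpDl.
near=> y; apply: le_trans (fL x y) _.
have : `|x - y| <= e / (L + 1).
  by near: y; apply: (cvgrPdist_le _ _).1; [exact: cvg_id|rewrite divr_gt0].
rewrite ler_pdivlMr// mulrC; apply: le_trans.
by rewrite ler_wpM2r// lerDl.
Unshelve. all: by end_near. Qed.

(** Otherwise some [2 ^ k] exceeds [C / (x - y)]. *)
Lemma le_add_geometric (x y C : R) : (forall k, x <= y + C / 2 ^+ k) -> x <= y.
Proof.
move=> H; rewrite leNgt; apply/negP => yx.
have xy0 : 0 < x - y by rewrite subr_gt0.
have C0 : 0 < C by have := H 0%N; rewrite expr0 divr1; lra.
have := archi_boundP (ltW (divr_gt0 C0 xy0)).
set k := Num.bound _ => kC; have := H k; rewrite -lerBlDl leNgt => /negP; apply.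
rewrite ltr_pdivrMr ?exprn_gt0// mulrC -ltr_pdivrMr//.
apply: (lt_le_trans kC); rewrite -natrX ler_nat ltnW//; exact: ltn_expl.
Qed.

(** The tail of the series from [k] on is at most [2 * D / 2 ^ k]. The intervals of that radius
    around [u k] are therefore nested, and the supremum of their left ends lies in all of them. *)
Lemma geometric_limit (u : nat -> R) D :
  (forall k, `|u k.+1 - u k| <= D / 2 ^+ k) ->
  exists l, forall k, `|l - u k| <= 2 * D / 2 ^+ k.
Proof.
move=> uD.
have step k : D / 2 ^+ k = 2 * (D / 2 ^+ k) - 2 * (D / 2 ^+ k.+1).
  rewrite exprS; have : (2 ^+ k : R) != 0 by rewrite expf_neq0// pnatr_eq0.
  by move=> h; field.
pose a k := u k - 2 * (D / 2 ^+ k); pose b k := u k + 2 * (D / 2 ^+ k).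
have aS k d : a k <= a (d + k)%N.
  elim: d => // d IH; apply: le_trans IH _; rewrite addSn /a.
  by have := uD (d + k)%N; have := step (d + k)%N; rewrite ler_norml => ? /andP[]; lra.
have bS k d : b (d + k)%N <= b k.
  elim: d => // d; apply: le_trans; rewrite addSn /b.
  by have := uD (d + k)%N; have := step (d + k)%N; rewrite ler_norml => ? /andP[]; lra.
have ab j k : a j <= b k.
  rewrite (le_trans (aS j k))// (le_trans _ (bS k j))// addnC /a /b.
  have : 0 <= D / 2 ^+ (j + k) := le_trans (normr_ge0 _) (uD _).
  lra.
exists (sup (range a)) => k.
have la : a k <= sup (range a).
  by apply: ub_le_sup; [exists (b k) => _ [j _ <-]|exists k].
have lb : sup (range a) <= b k.
  by apply: ge_sup => [|_ [j _ <-]]; [exists (a 0%N), 0%N|].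
by rewrite ler_norml; move: la lb; rewrite /a /b; lra.
Qed.

End Lipschitz.

Section Picard.
Context {R : realType} {n : nat}.

(** Clamping serves twice: in time it extends a curve on a segment to a continuous curve on the
    line, and in space it extends a field on a cube to a bounded, globally Lipschitz one. *)
Lemma clamp_lipschitz (l u x y : R) :
  `|Num.max l (Num.min x u) - Num.max l (Num.min y u)| <= `|x - y|.
Proof.
have max_lip a b : `|Num.max l a - Num.max l b| <= `|a - b|.
  by case: (leP l a); case: (leP l b) => ? ?; rewrite ler_norml;
    move: (ler_norm (a - b)) (ler_norm (b - a)); rewrite (distrC b); lra.
apply: le_trans (max_lip _ _) _.
by case: (leP x u); case: (leP y u) => ? ?; rewrite ler_norml;
    move: (ler_norm (x - y)) (ler_norm (y - x)); rewrite (distrC y); lra.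
Qed.

Lemma norm_le_center (f df : R -> R) (a C t : R) : 0 <= C -> `|t| <= a ->
  (forall t : R, `|t| <= a -> is_derive t 1 f (df t)) ->
  (forall t, `|t| <= a -> `|df t| <= C) -> `|f t - f 0| <= C * a.
Proof.
move=> C0 ta dfE dfC.
have [t0|/ltW t0] := leP 0 t.
  have tE : `|t| = t by rewrite ger0_norm.
  have sub s : 0 <= s <= t -> `|s| <= a.
    by move=> /andP[s0 st]; rewrite ger0_norm// (le_trans st)// -tE.
  apply: (@le_trans _ _ (C * (t - 0))); last by rewrite subr0 ler_wpM2l// -tE.
  by apply: (@mvt_bound _ f df) => // s /sub; [exact: dfE|exact: dfC].
have tE : `|t| = - t by rewrite ler0_norm.
have sub s : t <= s <= 0 -> `|s| <= a.
  by move=> /andP[st s0]; rewrite ler0_norm// (le_trans _ ta)// tE lerN2.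
rewrite distrC; apply: (@le_trans _ _ (C * (0 - t))).
  2: by rewrite sub0r ler_wpM2l// -tE.
by apply: (@mvt_bound _ f df) => // s /sub; [exact: dfE|exact: dfC].
Qed.

(* Successive iterates differ by at most [D / 2 ^ k]; the limit [z] is Lipschitz,
   hence continuous, and applying the integral operator [T] to it gives a
   function that is again within [2 D / 2 ^ k] of the iterates. *)
Lemma picard (Y : 'I_n -> 'rV[R]_n -> R^o) (z0 : 'rV[R]_n) (L M a : R) :
  0 <= L -> 0 <= M -> 0 < a -> L * a <= 2^-1 ->
  (forall i z w, `|Y i z - Y i w| <= L * `|z - w|) ->
  (forall i z, `|Y i z| <= M) ->
  exists w : R -> 'rV[R]_n, w 0 = z0 /\
    forall t : R, `|t| <= a -> forall i,
      is_derive t 1 (fun u => w u 0 i : R^o) (Y i (w t)).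
Proof.
move=> L0 M0 a0 La YL YM.
have cY i : continuous (Y i) by exact: lipschitz_continuous (YL i).
(* Continuity of [z] is a premise inside the existential, so that [choice] gives an operator [T] on
   all functions. *)
have step (z : R -> 'rV[R]_n) : exists w : R -> 'rV[R]_n, continuous z ->
    w 0 = z0 /\ forall (t : R) i, is_derive t 1 (fun u => w u 0 i : R^o) (Y i (z t)).
  have [cz|/asboolP nc] := pselect (continuous z); last first.
    by exists (fun=> z0) => cz; exfalso; move/asboolP : nc; exact.
  have /choice[F FP] : forall i, exists F : R -> R, F 0 = 0 /\
      forall t : R, setT t -> is_derive t 1 F (Y i (z t)).
    move=> i; apply: primitive => //; first exact: openT.
    by move=> t _; apply: continuous_comp; [exact: cz|exact: cY].
  exists (fun t => \row_i (z0 0 i + F i t)) => _; split=> [|t i].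
    by apply/rowP => i; rewrite mxE (FP i).1 addr0.
  rewrite (_ : (fun u => _) = cst (z0 0 i) + F i); last first.
    by apply/funext => u; rewrite mxE.
  have := is_deriveD (is_derive_cst (z0 0 i) t 1) ((FP i).2 t I).
  by rewrite add0r.
have [T TP] := choice step; clear step.
have cT (z : R -> 'rV[R]_n) : continuous z -> continuous (T z).
  move=> /TP[_ dz] t; apply: continuous_rV => j; exact: is_derive_continuous (dz t j).
have contr (z z' : R -> 'rV[R]_n) D : continuous z -> continuous z' ->
    (forall t, `|t| <= a -> `|z t - z' t| <= D) ->
    forall t, `|t| <= a -> `|T z t - T z' t| <= D / 2.
  move=> cz cz' zD t ta.
  have D0 : 0 <= D by exact: le_trans (normr_ge0 _) (zD _ ta).
  have [Tz0 dTz] := TP _ cz; have [Tz'0 dTz'] := TP _ cz'.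
  apply: rV_norm_le => [|j]; first by rewrite divr_ge0.
  have := @norm_le_center (fun u => T z u 0 j - T z' u 0 j)
    (fun u => Y j (z u) - Y j (z' u)) a (L * D) t.
  rewrite Tz0 Tz'0 subrr subr0 mulrAC !mxE => H.
  apply: le_trans (H _ _ _ _) _ => //; first exact: mulr_ge0.
  - by move=> s sa; rewrite (le_trans (YL _ _ _))// ler_wpM2l// zD.
  - by rewrite mulrC ler_wpM2l.
pose zs k := iter k T (fun=> z0).
have czs k : continuous (zs k).
  by elim: k => [|k IH]; [exact: cst_continuous|exact: cT].
pose D := M * a.
have D0 : 0 <= D by rewrite mulr_ge0// ltW.
have zsD k : forall t, `|t| <= a -> `|zs k.+1 t - zs k t| <= D / 2 ^+ k.
  elim: k => [|k IH] t ta.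
    rewrite expr0 divr1; have [Tz0 dTz] := TP _ (czs 0%N).
    apply: rV_norm_le => // j.
    have := @norm_le_center (fun u => zs 1%N u 0 j) (fun u => Y j (zs 0%N u)) a M t.
    by rewrite /= Tz0 !mxE; apply.
  rewrite exprSr invfM mulrA.
  exact: (contr (zs k.+1) (zs k) _ (czs _) (czs _) IH).
have /choice[z zP] : forall t, exists zt : 'rV[R]_n, `|t| <= a ->
    forall k, `|zt - zs k t| <= 2 * D / 2 ^+ k.
  move=> t; have [ta|_] := boolP (`|t| <= a); last by exists z0.
  have /choice[l lP] : forall j, exists l, forall k,
      `|l - zs k t 0 j| <= 2 * D / 2 ^+ k.
    move=> j; apply: geometric_limit => k.
    by apply: le_trans (zsD k t ta); have := coord_le_norm (zs k.+1 t - zs k t) j; rewrite !mxE.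
  exists (\row_j l j) => _ k; apply: rV_norm_le => [|j]; last by rewrite !mxE.
  by apply: divr_ge0; [exact: mulr_ge0|exact: exprn_ge0].
have zL t s : `|t| <= a -> `|s| <= a -> `|z t - z s| <= M * `|t - s|.
  wlog ts : t s / s <= t.
    move=> H; have [|/ltW] := leP s t; first exact: H.
    by move=> ? ta sa; rewrite distrC (distrC t); exact: H.
  move=> ta sa; apply: rV_norm_le => [|j]; first exact: mulr_ge0.
  apply: (@le_add_geometric _ _ _ (2 * D)) => k; rewrite !mxE.
  have [_ dTz] := TP _ (czs k).
  have Hzs : `|zs k.+1 t 0 j - zs k.+1 s 0 j| <= M * `|t - s|.
    rewrite (ger0_norm (x := t - s)) ?subr_ge0//.
    by apply: (@mvt_bound _ (fun u => zs k.+1 u 0 j) (fun u => Y j (zs k u))).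
  have e u : `|u| <= a -> `|z u 0 j - zs k.+1 u 0 j| <= D / 2 ^+ k.
    move=> ua; have := zP u ua k.+1; rewrite exprS.
    have := coord_le_norm (z u - zs k.+1 u) j; rewrite !mxE => h1 h2.
    rewrite (le_trans h1)// (le_trans h2)// invfM mulrACA divff ?mul1r// pnatr_eq0//.
  have := e t ta; have := e s sa; move: Hzs; rewrite -mulrA.
  rewrite !ler_norml => /andP[? ?] /andP[? ?] /andP[? ?]; lra.
(* The limit [z] is controlled only for [|t| <= a], while [T] is specified for functions continuous
   on the whole line; clamping the time reconciles the two. *)
pose cl (t : R) := Num.max (- a) (Num.min t a).
have cla t : `|cl t| <= a.
  by rewrite ler_norml /cl le_max lexx/= ge_max ge_min lexx orbT andbT; lra.
have clE t : `|t| <= a -> cl t = t.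
  by rewrite ler_norml /cl => /andP[h1 h2]; rewrite (min_idPl h2) (max_idPr h1).
have clL t s : `|cl t - cl s| <= `|t - s|.
  exact: clamp_lipschitz.
pose zc t := z (cl t).
have czc : continuous zc.
  apply: (@lipschitz_continuous _ _ _ zc M) => // t s.
  by rewrite (le_trans (zL _ _ (cla t) (cla s)))// ler_wpM2l.
have [w0 dw] := TP _ czc.
exists (T zc); split=> // t ta i.
have -> : T zc t = z t; last by rewrite -[in z t](clE t ta).
apply/eqP; rewrite -subr_eq0 -normr_le0; apply: (@le_add_geometric _ _ _ (2 * D)) => k.
rewrite add0r.
have h1 : `|T zc t - zs k.+1 t| <= 2 * D / 2 ^+ k / 2.
  by apply: contr => // s sa; rewrite /zc clE//; exact: zP.
have h2 : `|zs k.+1 t - z t| <= 2 * D / 2 ^+ k / 2.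
  by rewrite distrC -mulrA -invfM -exprSr; exact: zP.
rewrite -(subrK (zs k.+1 t) (T zc t)) -addrA (le_trans (ler_normD _ _))//.
by rewrite [leRHS]splitr lerD.
Qed.

(** The map [P] clamps each coordinate to distance [d] from [z0], so [Y = X o P] satisfies the
    global bounds that [picard] asks for. The time [a] is so short that the iteration contracts
    ([L * a <= 1/2]) and that the solution cannot leave the cube ([M * a <= d]), where [Y] and [X]
    agree. Adding 1 to [L] and [M] keeps the denominators positive. *)
Lemma ode_exists (O : set 'rV[R]_n) (X : 'I_n -> 'rV[R]_n -> R^o) z0 :
  open O -> O z0 -> (forall i, Ck 1 O (X i)) ->
  exists (a : R) (w : R -> 'rV[R]_n), [/\ 0 < a, w 0 = z0 &
    forall t : R, `|t| <= a -> O (w t) /\ forall i,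
      is_derive t 1 (fun u => w u 0 i : R^o) (X i (w t))].
Proof.
move=> oO Oz0 CX.
have /choice[eL eLP] : forall i, exists eL : R * R, [/\ 0 < eL.1, 0 <= eL.2 &
    forall z w, `|z - z0| < eL.1 -> `|w - z0| < eL.1 ->
      O z /\ `|X i z - X i w| <= eL.2 * `|z - w|].
  by move=> i; have [e [l H]] := C1_locally_lipschitz oO Oz0 (CX i); exists (e, l).
have /nbhs_ballP[e0 /= e00 He0] := open_nbhs_nbhs (conj oO Oz0).
pose e := \big[Num.min/e0]_i (eL i).1.
have e_gt0 : 0 < e.
  by apply: lt_bigmin => // i _; case: (eLP i).
have ele i : e <= (eL i).1 by exact: bigmin_le.
have ele0 : e <= e0 by exact: bigmin_le_id.
pose L := \sum_i (eL i).2.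
have leL i : (eL i).2 <= L.
  by rewrite /L (bigD1 i)//= lerDl sumr_ge0// => j _; case: (eLP j).
have L0 : 0 <= L by apply: sumr_ge0 => i _; case: (eLP i).
pose M := \sum_i `|X i z0| + L * e.
have XM i z : `|z - z0| < e -> `|X i z| <= M.
  move=> ze; have z0e : `|z0 - z0| < (eL i).1.
    by rewrite subrr normr0; case: (eLP i).
  have [_ _ /(_ z z0 (lt_le_trans ze (ele i)) z0e)[_ H]] := eLP i.
  rewrite -(subrK (X i z0) (X i z)) addrC (le_trans (ler_normD _ _))// /M lerD//.
    by rewrite (bigD1 i)//= lerDl sumr_ge0.
  by rewrite (le_trans H)// ler_pM//; [case: (eLP i)|exact: ltW].
have M0 : 0 <= M by rewrite addr_ge0// ?sumr_ge0// mulr_ge0// ltW.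
pose d := e / 2.
have d0 : 0 < d by rewrite divr_gt0.
pose P (z : 'rV[R]_n) : 'rV[R]_n :=
  \row_j Num.max (z0 0 j - d) (Num.min (z 0 j) (z0 0 j + d)).
have Pd z : `|P z - z0| < e.
  apply: (@le_lt_trans _ _ d); last by rewrite /d; lra.
  apply: rV_norm_le => [|j]; first exact: ltW.
  rewrite !mxE ler_norml lerBlDl lerBrDl ge_max le_max ge_min lexx/= lerD2l.
  by rewrite lexx orbT andbT; move: d0; lra.
have PL z w : `|P z - P w| <= `|z - w|.
  apply: rV_norm_le => // j; apply: le_trans (coord_le_norm (z - w) j); rewrite !mxE.
  exact: clamp_lipschitz.
have PE z : `|z - z0| <= d -> P z = z.
  move=> zd; apply/rowP => j; have := le_trans (coord_le_norm (z - z0) j) zd.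
  rewrite !mxE ler_norml => /andP[h1 h2].
  rewrite (min_idPl _); last by lra.
  by rewrite (max_idPr _)//; lra.
pose Y i z := X i (P z).
have YL i z w : `|Y i z - Y i w| <= L * `|z - w|.
  have [h1 h2 /(_ _ _ (lt_le_trans (Pd z) (ele i)) (lt_le_trans (Pd w) (ele i)))[_ H]] := eLP i.
  by rewrite (le_trans H)// ler_pM.
have YM i z : `|Y i z| <= M by exact: XM.
pose a := Num.min (2 * (L + 1))^-1 (d / (M + 1)).
have L1 : 0 < L + 1 by rewrite ltr_wpDl.
have M1 : 0 < M + 1 by rewrite ltr_wpDl.
have a0 : 0 < a by rewrite lt_min invr_gt0 mulr_gt0//= divr_gt0.
have La : L * a <= 2^-1.
  have : (L + 1) * a <= (L + 1) * (2 * (L + 1))^-1.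
    by apply: ler_wpM2l; [exact: ltW|rewrite ge_min lexx].
  rewrite invfM mulrCA divff ?mulr1 ?gt_eqF//; apply: le_trans.
  by rewrite ler_wpM2r ?(ltW a0)// lerDl.
have Ma : M * a <= d.
  have : (M + 1) * a <= (M + 1) * (d / (M + 1)).
    by apply: ler_wpM2l; [exact: ltW|rewrite ge_min lexx orbT].
  rewrite mulrCA divff ?mulr1 ?gt_eqF//; apply: le_trans.
  by rewrite ler_wpM2r ?(ltW a0)// lerDl.
have [w [w0 dw]] := picard z0 L0 M0 a0 La YL YM.
exists a, w; split=> // t ta.
have wt : `|w t - z0| <= d.
  apply: rV_norm_le => [|j]; first exact: ltW.
  rewrite -w0 !mxE (le_trans _ Ma)//.
  by apply: (@norm_le_center (fun u => w u 0 j) (fun u => Y j (w u))) => // s sa; exact: dw.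
split=> [|i]; last by have := dw t ta i; rewrite /Y PE.
apply: He0; rewrite mx_norm_ball /ball_/= distrC (le_lt_trans wt)//.
by rewrite (lt_le_trans _ ele0)// /d; lra.
Qed.

End Picard.

(** * Bump functions *)

Section Bump.
Context {R : realType}.

(* Up to linear combinations the family is closed under differentiation, so its
   smoothness reduces to differentiability at 0. *)
Definition flat (n : nat) (t : R) : R :=
  if 0 < t then t^-1 ^+ n * expR (- t^-1) else 0.

(** The exponential of [t^-1] dominates the term of degree [n + 2] of its series; two more powers
    than the [n] in [flat n] leave the factor [t ^ 2], which forces derivative 0 at 0. *)
Lemma flat_le (n : nat) (t : R) : `|flat n t| <= n.+2`!%:R * t ^+ 2.
Proof.
rewrite /flat; case: ifPn => [t0|_]; last by rewrite normr0 mulr_ge0// sqr_ge0.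
have ti0 : 0 < t^-1 by rewrite invr_gt0.
rewrite ger0_norm; last by rewrite mulr_ge0 ?expR_ge0// exprn_ge0// ltW.
rewrite expRN.
have f0 : 0 < n.+2`!%:R :> R by rewrite ltr0n fact_gt0.
have := @expR_ge1Dxn R t^-1 n.+1 (ltW ti0).
have p0 : 0 < t^-1 ^+ n.+2 / n.+2`!%:R by rewrite divr_gt0// exprn_gt0.
move=> H; have {}H : t^-1 ^+ n.+2 / n.+2`!%:R <= expR t^-1 by lra.
rewrite -ler_pdivlMl ?exprn_gt0//; apply: (@le_trans _ _ (t^-1 ^+ n.+2 / n.+2`!%:R)^-1).
  by rewrite lef_pV2// posrE expR_gt0.
rewrite invfM invrK -exprVn invrK -exprVn invrK -[n.+2]addn2 exprD.
by rewrite -mulrA (mulrC _ (_`!%:R)).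
Qed.

Lemma is_derive_flat (n : nat) (t : R) :
  is_derive t 1 (flat n) (flat n.+2 t - n%:R * flat n.+1 t).
Proof.
have [t0|t0|<-] := ltgtP 0 t.
- have ne : t != 0 by rewrite gt_eqF.
  have di : is_derive t 1 (fun u : R => u^-1) (- t^-1 ^+ 2).
    have := is_deriveV ne (is_derive_id t (1:R)).
    by rewrite [_ *: 1]mulr1 exprVn.
  have dx := is_deriveX n di.
  have de : is_derive t 1 (fun u : R => expR (- u^-1)) (expR (- t^-1) * (t^-1 ^+ 2)).
    have := @is_derive1_comp R expR (fun u => - u^-1) t _ _ (is_derive_expR _)
      (is_deriveN di).
    by rewrite opprK.
  have := is_deriveM dx de.
  move=> /near_eq_is_derive H; apply: is_derive_eq (H _ _) _.
    by apply: filterS (lt_nbhsr t0) => u u0; rewrite /flat u0 !fctE.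
  rewrite /flat t0 !fctE /GRing.scale/=; rewrite !exprS.
  case: n {dx H} => [|k]; rewrite /= ?mul0r ?expr0 ?exprS -?[k.+1]addn1 ?natrD.
    by ring.
    ring.
- have -> : flat n.+2 t - n%:R * flat n.+1 t = 0.
    by rewrite /flat ltNge (ltW t0)/= mulr0 subr0.
  apply: near_eq_is_derive (is_derive_cst 0 t (1:R)).
  by apply: filterS (lt_nbhsl t0) => u u0; rewrite /flat ltNge (ltW u0).
- rewrite /flat ltxx mulr0 subr0; apply/is_derive1_caratheodory.
  (* The slope function of Caratheodory's criterion at 0. Its value there is 0 by the convention
     that 0 has inverse 0, and [flat_le] bounds it by a multiple of [|z|]. *)
  exists (fun z => flat n z / z); split=> [z||]; last by rewrite invr0 mulr0.
    rewrite ltxx !subr0; have [->|z0] := eqVneq z 0.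
      by rewrite mulr0 /flat ltxx.
    by rewrite divfK.
  apply/cvgrPdist_le => /= e e0; rewrite invr0 mulr0.
  have C0 : 0 < n.+2`!%:R + 1 :> R by rewrite ltr_wpDl.
  near=> z; rewrite sub0r normrN.
  have : `|z| <= e / (n.+2`!%:R + 1).
    near: z; exists (e / (n.+2`!%:R + 1)); first exact: divr_gt0.
    by move=> z /=; rewrite sub0r normrN => /ltW.
  rewrite ler_pdivlMr// mulrC; apply: le_trans.
  have [->|z0] := eqVneq z 0; first by rewrite invr0 mulr0 normr0 mulr0.
  rewrite normrM normfV ler_pdivrMr ?normr_gt0// -mulrA -expr2 real_normK ?num_real//.
  by rewrite (le_trans (flat_le n z))// ler_wpM2r ?sqr_ge0// lerDl.
Unshelve. all: by end_near. Qed.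

Lemma derive_comp_real (V : normedModType R) (g : V -> R^o) (f : R -> R) z v d :
  differentiable g z -> is_derive (g z) 1 f d ->
  'D_v (fun y => f (g y) : R^o) z = d * 'D_v g z.
Proof.
move=> dg [dfz <-]; have df : differentiable (f : R^o -> R^o) (g z) by exact/derivable1_diffP.
rewrite -[fun y => _]/(f \o g) deriveE; last exact: differentiable_comp.
by rewrite diff_comp//= deriv1E// derive1E -deriveE// mulrC.
Qed.

Lemma Ck_flat m k n (O : set 'rV[R]_m) (g : 'rV[R]_m -> R^o) : open O ->
  Ck k O g -> Ck k O (fun z => flat n (g z)).
Proof.
move=> oO; elim: k n => [|k IH] n.
  move=> cg z Oz; apply: continuous_comp (cg z Oz) _.
  exact: is_derive_continuous (is_derive_flat n (g z)).
move=> Cg; have [dg Dg] := Cg.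
have dflat z : differentiable (flat n : R -> R) (g z).
  by apply/derivable1_diffP; case: (is_derive_flat n (g z)).
split=> [z Oz|i].
  exact: (differentiable_comp (dg z Oz) (dflat z)).
have C1 := IH n.+1 (Ck_pred Cg); have C2 := IH n.+2 (Ck_pred Cg).
have := Ck_mul oO (Ck_add oO C2 (Ck_scale (- n%:R) oO C1)) (Dg i).
apply: Ck_ext => // z Oz.
rewrite (derive_comp_real _ (dg z Oz) (is_derive_flat n (g z))).
by rewrite mulNr.
Qed.

(** The norm of the space is the maximum norm, which is not smooth, so [q] uses the Euclidean
    square. Where [q] is positive, each coordinate is within [d] of that of [z0]; this puts the
    support in the cube [K], and [d = e / 2] puts the cube in the ball of radius [e]. *)
Lemma bump_rV m (O : set 'rV[R]_m) z0 : open O -> O z0 ->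
  exists (B : 'rV[R]_m -> R^o) (K : set 'rV[R]_m),
    [/\ forall k, Ck k setT B, B z0 = 1, compact K, K `<=` O &
        forall z, B z != 0 -> K z].
Proof.
move=> oO Oz0; have /nbhs_ballP[e /= e0 He] := open_nbhs_nbhs (conj oO Oz0).
pose d := e / 2; have d0 : 0 < d by rewrite divr_gt0.
pose q (z : 'rV[R]_m) : R := d ^+ 2 - \sum_(i < m) (z 0 i - z0 0 i) * (z 0 i - z0 0 i).
have qE : q z0 = d ^+ 2.
  by rewrite /q big1 ?subr0// => i _; rewrite subrr mulr0.
have fq0 : flat 0 (q z0) != 0.
  by rewrite qE /flat exprn_gt0// expr0 mul1r gt_eqF// expR_gt0.
pose K := [set z : 'rV[R]_m | forall i, [set` `[z0 0 i - d, z0 0 i + d]] (z 0 i)].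
exists (fun z => (flat 0 (q z0))^-1 * flat 0 (q z)), K; split.
- move=> k; apply: Ck_scale; first exact: openT.
  apply: Ck_flat; first exact: openT.
  rewrite /q; apply: Ck_add; [exact: openT|exact: Ck_cst|].
  rewrite (_ : (fun z : 'rV[R]_m => - _) = fun z => -1 * \sum_(i < m) (z 0 i - z0 0 i) * (z 0 i - z0 0 i)).
    apply: Ck_scale; first exact: openT.
    apply: Ck_sum => [|i]; first exact: openT.
    by apply: Ck_mul; [exact: openT| |]; apply: Ck_add;
      [exact: openT|exact: Ck_coord|exact: Ck_cst| exact: openT|exact: Ck_coord|exact: Ck_cst].
  by apply/funext => z; rewrite mulN1r.
- by rewrite mulVf.
- apply: (@rV_compact _ _ (fun i => [set` `[z0 0 i - d, z0 0 i + d]])) => i.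
  exact: segment_compact.
- move=> z Kz; apply: He; rewrite mx_norm_ball /ball_/=.
  apply: (@le_lt_trans _ _ d); last by rewrite /d; lra.
  apply: rV_norm_le => [|j]; first exact: ltW.
  have := Kz j; rewrite /= in_itv/= !mxE ler_norml => /andP[]; lra.
- move=> z; rewrite mulf_eq0 invr_eq0 (negPf fq0)/= /flat.
  case: ifPn => [q0 _ i|_]; last by rewrite eqxx.
  have : (z 0 i - z0 0 i) ^+ 2 <= d ^+ 2.
    rewrite expr2 (le_trans _ (ltW (_ : \sum_(i < m) (z 0 i - z0 0 i) * (z 0 i - z0 0 i) < _)))//.
      by rewrite (bigD1 i)//= lerDl sumr_ge0// => j _; rewrite -expr2 sqr_ge0.
    by rewrite -subr_gt0.
  rewrite -ler_sqrt ?sqr_ge0// !sqrtr_sqr (gtr0_norm d0) ler_norml /= in_itv/=.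
  by move=> /andP[]; lra.
Qed.

End Bump.

(** * Smooth functions and cut-offs on a manifold *)

Section SmoothNear.
Context {R : realType} {T : Type} {n : nat}.
Implicit Types (A : set (chart R T n)) (p : T) (f g : T -> R^o).

Lemma smooth_near_Ck A p f k : smooth_near A p f -> Ck_near A k p f.
Proof. by move=> sf c Ac cp; have [U [oU Up CU]] := sf c Ac cp; exists U. Qed.

Lemma smooth_near_cst A p (a : R) : smooth_near A p (fun=> a).
Proof. by move=> c _ _; exists setT; split=> //; [exact: openT|move=> k; exact: Ck_cst]. Qed.

Lemma smooth_near_op (op : R -> R -> R) A p f g :
  (forall k (U : set 'rV[R]_n) (f g : 'rV[R]_n -> R^o), open U ->
     Ck k U f -> Ck k U g -> Ck k U (fun z => op (f z) (g z))) ->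
  smooth_near A p f -> smooth_near A p g ->
  smooth_near A p (fun q => op (f q) (g q)).
Proof.
move=> H sf sg c Ac cp.
have [U [oU Up CU]] := sf c Ac cp; have [V [oV Vp CV]] := sg c Ac cp.
exists (U `&` V); split=> [||k]; [exact: openI|by split|].
apply: H; first exact: openI.
- by apply: Ck_sub (CU k) => z [].
- by apply: Ck_sub (CV k) => z [].
Qed.

Lemma smooth_near_add A p f g : smooth_near A p f -> smooth_near A p g ->
  smooth_near A p (fun q => f q + g q).
Proof. by apply: smooth_near_op => k U ? ?; exact: Ck_add. Qed.

Lemma smooth_near_mul A p f g : smooth_near A p f -> smooth_near A p g ->
  smooth_near A p (fun q => f q * g q).
Proof. by apply: smooth_near_op => k U ? ?; exact: Ck_mul. Qed.

End SmoothNear.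

Section Manifold.
Context {R : realType} {m : nat} {M : manifold R m}.
Implicit Types (c d : chart R M m) (p q : M) (f g : M -> R^o).

Lemma cinvK c p : charts M c -> cdom c p -> cinv c (cmap c p) = p.
Proof. by move=> /charts_homeo[_ _ H _ _]; exact: H. Qed.

Lemma image_cdom c z : charts M c -> (cmap c @` cdom c) z ->
  cdom c (cinv c z) /\ cmap c (cinv c z) = z.
Proof. by move=> Mc [p cp <-]; rewrite cinvK. Qed.

Lemma near_cinv c p (N : set M) : charts M c -> cdom c p -> nbhs p N ->
  \forall z \near cmap c p, (cmap c @` cdom c) z /\ N (cinv c z).
Proof.
move=> Mc cp Np; have [_ oI K _ cI] := charts_homeo Mc.
apply: filterI; first by apply: open_nbhs_nbhs; split=> //; exists p.
by have := cI _ (ex_intro2 _ _ p cp erefl) N; apply; rewrite K.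
Qed.

Lemma nbhs_open (T : topologicalType) (x : T) (A : set T) : nbhs x A ->
  exists U, [/\ open U, U x & U `<=` A].
Proof. by rewrite nbhsE => -[U [oU Ux] UA]; exists U. Qed.

Lemma near_cmap c p (U : set 'rV[R]_m) : charts M c -> cdom c p ->
  nbhs (cmap c p) U -> \forall q \near p, cdom c q /\ U (cmap c q).
Proof.
move=> Mc cp Up; have [oc _ _ cc _] := charts_homeo Mc.
apply: filterI; first exact: open_nbhs_nbhs.
exact: (cc _ cp).
Qed.

Lemma smooth_near_ext p f g : (\forall q \near p, f q = g q) ->
  smooth_near (charts M) p f -> smooth_near (charts M) p g.
Proof.
move=> fg sf c Mc cp; have [U [oU Up CU]] := sf c Mc cp.
have [V [oV Vp HV]] := nbhs_open (near_cinv Mc cp fg).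
exists (U `&` V); split=> [||k]; [exact: openI|by split|].
apply: Ck_ext (Ck_sub _ (CU k)); first exact: openI.
  by move=> z [_ /HV[_]].
by move=> z [].
Qed.

(** Change of chart ([G = id]) and composition with a smooth map are both instances. The type [T]
    carries no topology, so continuity of [G] at [p] is expressed through the charts in [A]. *)
Lemma smooth_near_pull (T : Type) n (A : set (chart R T n)) (p : T) (G : T -> M) c
    (U : set 'rV[R]_m) f :
  charts M c -> cdom c (G p) -> open U -> U (cmap c (G p)) ->
  (forall k, Ck k U (fun z => f (cinv c z))) ->
  (forall i, smooth_near A p (fun x : T => cmap c (G x) 0 i)) ->
  (forall d : chart R T n, A d -> cdom d p -> forall N, nbhs (G p) N ->
     \forall z \near cmap d p, N (G (cinv d z))) ->
  smooth_near A p (fun x : T => f (G x)).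
Proof.
move=> Mc cp oU Up CU sG cG d Ad dp.
have : forall i, exists V, [/\ open V, V (cmap d p) &
    forall k, Ck k V (fun z => cmap c (G (cinv d z)) 0 i)].
  by move=> i; exact: (sG i d Ad dp).
move=> /choice[V VP].
have nU : nbhs (cmap c (G p)) U by exact: open_nbhs_nbhs.
have : \forall z \near cmap d p, (forall i, V i z) /\
    (cdom c (G (cinv d z)) /\ U (cmap c (G (cinv d z)))).
  apply: filterI; last exact: (cG d Ad dp _ (near_cmap Mc cp nU)).
  near=> z => i; move: i; near: z; apply: filter_forall => i.
  by have [oV Vp _] := VP i; exact: open_nbhs_nbhs.
move=> /nbhs_open[N [oN Np HN]]; exists N; split=> // k.
have CN j : Ck k N (fun z => cmap c (G (cinv d z)) 0 j).
  by have [_ _ CV] := VP j; apply: Ck_sub (CV k) => z /HN[].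
have NU z : N z -> U (cmap c (G (cinv d z))) by move=> /HN[_ []].
apply: Ck_ext (Ck_comp oN NU (CU k) CN) => // z /HN[_ [cz _]].
by rewrite cinvK.
Unshelve. all: by end_near. Qed.

Lemma smooth_near_chart c p (U : set 'rV[R]_m) f : charts M c -> cdom c p ->
  open U -> U (cmap c p) -> (forall k, Ck k U (fun z => f (cinv c z))) ->
  smooth_near (charts M) p f.
Proof.
move=> Mc cp oU Up CU.
apply: (smooth_near_pull (G := id) Mc cp oU Up CU).
  by move=> i; exact: charts_compat.
by move=> d Md dp N /(near_cinv Md dp); apply: filterS => z [].
Qed.

Lemma smooth_near_comp (F : M -> M) p f : smooth_map F ->
  smooth_near (charts M) (F p) f -> smooth_near (charts M) p (fun q => f (F q)).
Proof.
move=> sF sf; have [c Mc cp] := charts_cover (F p).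
have [U [oU Up CU]] := sf c Mc cp; have [cF sFc] := sF p.
apply: (smooth_near_pull Mc cp oU Up CU); first exact: sFc.
by move=> d Md dp N /cF /(near_cinv Md dp); apply: filterS => z [].
Qed.

Lemma near_hausdorff p q : p != q ->
  exists A B : set M, [/\ open A, open B, A p, B q & forall x, A x -> ~ B x].
Proof.
have := @m_hausdorff _ _ M; rewrite open_hausdorff => /[apply].
move=> [[A B] /= [/set_mem Ap /set_mem Bq] [oA oB AB]].
exists A, B; split=> // x Ax Bx.
by have : (A `&` B) x by []; rewrite (eqP AB).
Qed.

Lemma manifold_open_neq p : open [set q : M | q <> p].
Proof.
rewrite openE => q /= /eqP /near_hausdorff[A [B [oA _ Aq Bp AB]]].
apply: filterS (open_nbhs_nbhs (conj oA Aq)) => x Ax xp; rewrite xp in Ax.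
exact: AB Ax Bp.
Qed.

(** The support is the image of a compact set under a chart, hence closed because the manifold is
    Hausdorff. Every point thus lies either in the chart domain or in an open set where [chi] is 0,
    and extension by 0 is smooth. *)
Lemma bump_manifold p (U : set M) : open U -> U p ->
  exists (chi : M -> R^o) (K : set M), [/\ smooth_fun chi, chi p = 1,
    closed K, K `<=` U & forall q, chi q != 0 -> K q].
Proof.
move=> oU Up; have [c Mc cp] := charts_cover p.
have [_ oI K0 cc cI] := charts_homeo Mc.
have nU : nbhs p U by exact: open_nbhs_nbhs.
have [V [oV Vp HV]] := nbhs_open (near_cinv Mc cp nU).
have [B [L [CB Bp cL LV BL]]] := bump_rV oV Vp.
pose chi q : R^o := if `[< cdom c q >] then B (cmap c q) else 0.
pose K := cinv c @` L.
have cK : closed K.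
  apply: compact_closed; first exact: m_hausdorff.
  apply: continuous_compact cL; apply: continuous_in_subspaceT => z /set_mem Lz.
  by apply: cI; have [] := HV _ (LV _ Lz).
have chiK q : chi q != 0 -> K q.
  rewrite /chi; case: asboolP => [cq /BL Lq|_]; last by rewrite eqxx.
  by exists (cmap c q); rewrite ?cinvK.
exists chi, K; split=> //.
- move=> q; have [Kq|nKq] := pselect (K q); last first.
    apply: (@smooth_near_ext q (fun=> 0)); last exact: smooth_near_cst.
    have oKC : open (~` K) by exact: closed_openC.
    apply: filterS (open_nbhs_nbhs (conj oKC nKq)) => x nKx.
    by apply/esym/eqP; apply: contraPT nKx => /chiK Kx; exact.
  have cq : cdom c q.
    by have [z Lz <-] := Kq; have [/(image_cdom Mc)[]] := HV _ (LV _ Lz).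
  apply: (smooth_near_chart Mc cq oI); first by exists q.
  move=> k; apply: Ck_ext (Ck_sub _ (CB k)) => // z /(image_cdom Mc)[cz zE].
  by rewrite /chi asboolT// zE.
- by rewrite /chi asboolT.
- by move=> q [z Lz <-]; have [] := HV _ (LV _ Lz).
Qed.

Lemma smooth_bump_mul (chi f : M -> R^o) (U K : set M) : open U -> closed K ->
  K `<=` U -> smooth_fun chi -> (forall q, chi q != 0 -> K q) ->
  (forall q, U q -> smooth_near (charts M) q f) ->
  smooth_fun (fun q => chi q * f q : R^o).
Proof.
move=> oU cK KU schi chiK sf q; have [Uq|nUq] := pselect (U q).
  by apply: smooth_near_mul => //; exact: sf.
apply: (@smooth_near_ext q (fun=> 0)); last exact: smooth_near_cst.
have oKC : open (~` K) by exact: closed_openC.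
have nKq : (~` K) q by move=> /KU.
apply: filterS (open_nbhs_nbhs (conj oKC nKq)) => x nKx.
suff -> : chi x = 0 by rewrite mul0r.
by apply/eqP; apply: contraPT nKx => /chiK Kx; exact.
Qed.

End Manifold.

(** * Frames and the anchor *)

Section FrameTheory.
Context {R : realType} {m : nat} {M : manifold R m} {r : nat} (E : vbundle M r).
Implicit Types (s : frame E r) (x : M).

Lemma frame_sum s x (u : E x) : frames E s -> fdom s x ->
  u = \sum_(a < r) fco s u 0 a *: fvec s a x.
Proof. by move=> /frames_frame[_ H] /H[H1 _]; exact: H1. Qed.

Lemma fcoK s x (y : 'rV[R]_r) : frames E s -> fdom s x ->
  fco s (\sum_(a < r) y 0 a *: fvec s a x) = y.
Proof. by move=> /frames_frame[_ H] /H[_ H2]; exact: H2. Qed.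

Lemma fco_linear s x (k : R) (u v : E x) : frames E s -> fdom s x ->
  fco s (k *: u + v) = k *: fco s u + fco s v.
Proof.
move=> Es sx; rewrite {1}(frame_sum u Es sx) {1}(frame_sum v Es sx).
rewrite scaler_sumr -big_split/= -[RHS](fcoK _ Es sx); congr fco.
by apply: eq_bigr => a _; rewrite !mxE scalerDl scalerA.
Qed.

Lemma fco0 s x : frames E s -> fdom s x -> fco s (0 : E x) = 0.
Proof.
move=> Es sx; rewrite -[LHS](addrK (fco s (0 : E x))).
by rewrite -[X in X + _ - _]scale1r -fco_linear// scale1r addr0 addrN.
Qed.

Lemma fcoZ s x (k : R) (u : E x) : frames E s -> fdom s x ->
  fco s (k *: u) = k *: fco s u.
Proof. by move=> Es sx; rewrite -[k *: u]addr0 fco_linear// fco0// addr0. Qed.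

Lemma fcoD s x (u v : E x) : frames E s -> fdom s x ->
  fco s (u + v) = fco s u + fco s v.
Proof. by move=> Es sx; have := fco_linear 1 u v Es sx; rewrite !scale1r. Qed.

Lemma fco_sum s x (I : finType) (F : I -> E x) : frames E s -> fdom s x ->
  fco s (\sum_i F i) = \sum_i fco s (F i).
Proof.
move=> Es sx; apply: (big_morph (@fco _ _ _ _ s x)); last exact: fco0.
by move=> u v; exact: fcoD.
Qed.

Lemma fco_fvec s x a b : frames E s -> fdom s x ->
  fco s (fvec s a x) 0 b = (a == b)%:R.
Proof.
move=> Es sx; transitivity ((delta_mx 0 a : 'rV[R]_r) 0 b).
  rewrite -[in RHS](fcoK (delta_mx 0 a : 'rV[R]_r) Es sx); congr (fco s _ 0 b).
  rewrite (bigD1 a)//= big1 => [|c ca]; rewrite !mxE !eqxx/= ?scale1r ?addr0//.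
  by rewrite (negPf ca) scale0r.
by rewrite mxE eqxx eq_sym.
Qed.

Lemma fdom_open s : frames E s -> open (fdom s).
Proof. by move=> /frames_frame[]. Qed.

Lemma near_fdom s x : frames E s -> fdom s x -> \forall q \near x, fdom s q.
Proof. by move=> Es sx; apply: open_nbhs_nbhs; split=> //; exact: fdom_open. Qed.

End FrameTheory.

Section Anchor.
Context {R : realType} {m : nat} {M : manifold R m} {r : nat}.
Context {E : vbundle M r} {h eta : diffeo M} (A : gen_lie_algebroid E h eta).

(** The axioms of the bracket concern global sections; this makes them applicable to members of a
    local frame. *)
Lemma cutoff_section (s : frame E r) a (chi : M -> R^o) (K : set M) : frames E s ->
  smooth_fun chi -> closed K -> K `<=` fdom s ->
  (forall q, chi q != 0 -> K q) ->
  smooth_sec (E := E) (fun q => chi q *: fvec s a q : E q).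
Proof.
move=> Es schi cK Ks chiK s' x Es' s'x b.
pose f q : R^o := fco s' (fvec s a q) 0 b.
have sf : \forall q \near x, chi q * f q = fco s' (chi q *: fvec s a q) 0 b.
  by apply: filterS (near_fdom Es' s'x) => q s'q; rewrite fcoZ// mxE.
apply: smooth_near_ext sf _; have [sx|nsx] := pselect (fdom s x).
  by apply: smooth_near_mul => //; exact: frames_compat.
apply: (@smooth_near_ext _ _ _ _ (fun=> 0)); last exact: smooth_near_cst.
have oKC : open (~` K) by exact: closed_openC.
have nKx : (~` K) x by move=> /Ks.
apply: filterS (open_nbhs_nbhs (conj oKC nKx)) => q nKq.
suff -> : chi q = 0 by rewrite mul0r.
by apply/eqP; apply: contraPT nKq => /chiK Kq; exact.
Qed.

(* If [u] vanishes near [y] then [u, f v] vanishes at [y], and the Leibniz rule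
   leaves only the anchor term. *)
Lemma anchor_cutoff (u v : forall q, E q) (f : M -> R^o) (x : M) :
  smooth_sec (E := E) u -> smooth_sec (E := E) v ->
  smooth_fun f -> (\forall q \near h (eta x), u q = 0) ->
  gl_anchor A (u x) (fun z => f (h z)) *: v (h (eta x)) = 0.
Proof.
move=> su sv sf u0.
have s0 : smooth_sec (E := E) (fun q => 0 : E q).
  move=> s q Es sq a; apply: (@smooth_near_ext _ _ _ _ (fun=> 0)); last exact: smooth_near_cst.
  by apply: filterS (near_fdom Es sq) => z sz; rewrite fco0// mxE.
have br0 w : smooth_sec (E := E) w -> gl_br A u w (h (eta x)) = 0.
  move=> sw; rewrite (@gl_local _ _ _ _ _ _ _ A u (fun q => 0) w w)//; last exact: filterE.
  have := gl_br_linear A 1 s0 s0 sw (h (eta x)).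
  have -> : (fun q : M => 1 *: 0 + 0 : E q) = (fun q => 0).
    by apply: functional_extensionality_dep => q; rewrite scaler0 addr0.
  rewrite scale1r => /(congr1 (fun z => z - gl_br A (fun q => 0) w (h (eta x)))).
  by rewrite addrK subrr.
have sfv : smooth_sec (E := E) (fun q => f q *: v q).
  move=> s q Es sq a; apply: (@smooth_near_ext _ _ _ _ (fun q => f q * fco s (v q) 0 a)).
    by apply: filterS (near_fdom Es sq) => z sz; rewrite fcoZ// mxE.
  by apply: smooth_near_mul; [exact: sf|exact: sv].
have := gl_br_leibniz A su sv sf (h (eta x)).
by rewrite !br0// scaler0 add0r !diffeo_funK => <-.
Qed.

(* Test functions: the coordinates of a chart, centred at [p] and cut off by a
   bump function. *)
Lemma tangent_eq0 p (D : (M -> R^o) -> R^o) : tangent_at (charts M) p D ->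
  (forall f, smooth_fun f -> D f = 0) -> D = 0.
Proof.
move=> tD D0; have [c Mc cp] := charts_cover p.
have [xi DE] := tD c Mc cp; rewrite DE big1// => i _.
suff -> : xi 0 i = 0 by rewrite scale0r.
have [oc _ _ _ _] := charts_homeo Mc.
have [chi [K [schi chip cK Kc chiK]]] := bump_manifold oc cp.
pose co q : R^o := cmap c q 0 i - cmap c p 0 i.
pose f q : R^o := chi q * co q.
have sf : smooth_fun f.
  apply: (smooth_bump_mul oc cK Kc schi chiK) => q cq.
  by apply: smooth_near_add; [exact: charts_compat|exact: smooth_near_cst].
have := D0 f sf; rewrite DE fct_sumE.
have [U [oU Up CU]] := schi p c Mc cp.
have dchi : differentiable (fun z => chi (cinv c z) : R^o) (cmap c p).
  by have [+ _] := CU 1%N; exact.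
pose co' (z : 'rV[R]_m) : R^o := z 0 i - cmap c p 0 i.
have dco v : is_derive (cmap c p) v co' (v 0 i).
  have dcoord : is_derive (cmap c p) v (fun z : 'rV[R]_m => z 0 i : R^o) (v 0 i).
    apply: DeriveDef; last exact: derive_coord.
    exact/diff_derivable/differentiable_coord.
  have := is_deriveB dcoord (is_derive_cst (cmap c p 0 i : R^o) (cmap c p) v).
  by rewrite subr0.
have pdf j : pd (charts M) c p j f = (i == j)%:R.
  rewrite /pd asboolT; last exact/smooth_near_Ck/sf.
  have E1 : \forall z \near cmap c p, ((fun z => chi (cinv c z) : R^o) * co') z = f (cinv c z).
    have [_ oI _ _ _] := charts_homeo Mc.
    have Ip : (cmap c @` cdom c) (cmap c p) by exists p.
    apply: filterS (open_nbhs_nbhs (conj oI Ip)) => z /(image_cdom Mc)[_ zE].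
    by rewrite /f /co zE.
  rewrite -(near_eq_derive _ E1).
  have dj := dco (delta_mx 0 j).
  rewrite deriveM; [|exact: diff_derivable|by case: dj].
  rewrite (@derive_val _ _ _ _ _ _ _ dj) cinvK// chip scale1r /co' subrr scale0r addr0.
  by rewrite mxE eqxx eq_sym.
rewrite (bigD1 i)//= big1 ?addr0 => [|j ji]; last first.
  by rewrite -[LHS]/(xi 0 j * pd (charts M) c p j f) pdf eq_sym (negPf ji) mulr0.
by rewrite -[X in X = 0 -> _]/(xi 0 i * pd (charts M) c p i f) pdf eqxx mulr1.
Qed.

(** Since [h (eta x)] differs from [x], the frame vector can be cut off to a section that keeps its
    value at [x] and vanishes near [h (eta x)]. The Leibniz rule at [h (eta x)] involves the anchor
    at [x], so [anchor_cutoff] applies, with a second section that is nonzero at [h (eta x)]. *)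
Lemma anchor_vanish s a x : frames E s -> fdom s x -> h (eta x) <> x ->
  gl_anchor A (fvec s a x) = 0.
Proof.
move=> Es sx nx; set y := h (eta x).
have oU : open (fdom s `&` [set q | q <> y]).
  by apply: openI; [exact: fdom_open|exact: manifold_open_neq].
have Ux : (fdom s `&` [set q | q <> y]) x by split=> // /esym.
have [chi [K [schi chix cK KU chiK]]] := bump_manifold oU Ux.
have [s' Es' s'y] := frames_cover E y.
have [chi' [K' [schi' chiy cK' KU' chiK']]] := bump_manifold (fdom_open Es') s'y.
have su := cutoff_section a Es schi cK (fun q Kq => (KU q Kq).1) chiK.
have sv := cutoff_section a Es' schi' cK' KU' chiK'.
have oKC : open (~` K) by exact: closed_openC.
have nKy : (~` K) y by move=> /KU[_]; exact.
have u0 : \forall q \near y, (chi q *: fvec s a q : E q) = 0.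
  apply: filterS (open_nbhs_nbhs (conj oKC nKy)) => q nKq.
  suff -> : chi q = 0 by rewrite scale0r.
  by apply/eqP; apply: contraPT nKq => /chiK Kq; exact.
apply: tangent_eq0 (gl_anchor_tangent A (fvec s a x)) _ => f sf.
(* The anchor acts on functions of the form [f' o h]; as [h] is a diffeomorphism, every smooth [f]
   is of this form. *)
pose f' q : R^o := f (diffeo_inv h q).
have sf' : smooth_fun f'.
  by move=> q; exact: (smooth_near_comp (@diffeo_inv_smooth _ _ _ h) (sf _)).
have := anchor_cutoff su sv sf' u0.
rewrite chix scale1r (_ : (fun z => f' (h z)) = f); last first.
  by apply/funext => z; rewrite /f' diffeo_funK.
rewrite -/y chiy scale1r => /(congr1 (fun w => fco s' w 0 a)).
by rewrite fcoZ// fco0// !mxE fco_fvec// eqxx mulr1.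
Qed.

Lemma diffeo_continuous (F : diffeo M) : continuous F.
Proof. by move=> p; have [] := diffeo_smooth F p. Qed.

Lemma diffeo_inv_continuous (F : diffeo M) : continuous (diffeo_inv F).
Proof. by move=> p; have [] := diffeo_inv_smooth F p. Qed.

(** If [h x] is not fixed by [h o eta], neither are the points near it, and the anchor vanishes
    there. If it is fixed, injectivity of [h] gives [eta (h x) = x], so the chart around [x] is one
    around [eta (h x)], as [gl_anchor_smooth] requires. *)
Lemma rho_smooth (k : natchart (E := E)) x i b : adapted (h := h) k x ->
  smooth_near (charts M) x (fun q => rho_co A k q i b : R^o).
Proof.
move=> [[Mc cx] [Es sx] [Ehs hsx]]; rewrite /rho_co.
have [hx|nhx] := pselect (h (eta (h x)) = h x); last first.
  apply: (@smooth_near_ext _ _ _ _ (fun=> 0)); last exact: smooth_near_cst.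
  have : \forall q \near h x, fdom (nc_hframe k) q /\ h (eta q) <> q.
    apply: filterI; first exact: near_fdom.
    have /eqP/near_hausdorff[U [V [oU oV Up Vq UV]]] := nhx.
    have cU : \forall q \near h x, U (h (eta q)).
      have : {for h x, continuous (h \o eta)}.
        by apply: continuous_comp; exact: diffeo_continuous.
      by apply; exact: open_nbhs_nbhs.
    apply: filterS (filterI cU (open_nbhs_nbhs (conj oV Vq))) => q [Uq Vq'] qE.
    by rewrite qE in Uq; exact: UV Uq Vq'.
  move=> H; have := @diffeo_continuous h x _ H.
  apply: (@filterS _ (nbhs x)) => q [sq nq].
  by rewrite (anchor_vanish _ Ehs sq nq).
have ex : eta (h x) = x by apply: (can_inj (diffeo_funK h)); exact: hx.
apply: (smooth_near_comp (f := fun q => gl_anchor A (fvec (nc_hframe k) b q)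
  (fun z => cmap (nc_chart k) z 0 i)) (@diffeo_smooth _ _ _ h)).
by apply: gl_anchor_smooth => //; rewrite ex.
Qed.

End Anchor.

(** * Coordinates on the total space *)

Section BundleChart.
Context {R : realType} {m : nat} {M : manifold R m} {r : nat}.
Context {E : vbundle M r} {h : diffeo M}.
Implicit Types (k : natchart (E := E)) (p q : tot E) (f g : tot E -> R^o).

Local Notation adapted := (adapted (h := h)).
Local Notation tcharts := (@tot_charts R m M r E).

Definition nc_bundle k := bundle_chart (nc_chart k) (nc_frame k).

(* The range of the bundle chart of [k] over the points to which [k] is adapted. *)
Definition nc_image k : set 'rV[R]_(m + r) :=
  [set z | (cmap (nc_chart k) @` cdom (nc_chart k)) (lsubmx z) /\
           adapted k (cinv (nc_chart k) (lsubmx z))].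

Lemma adapted_exists x : exists k, adapted k x.
Proof.
have [c Mc cx] := charts_cover x; have [s Es sx] := frames_cover E x.
by have [s' Es' s'x] := frames_cover E (h x); exists (NatChart c s s').
Qed.

Lemma near_adapted k (x : M) : adapted k x -> \forall y \near x, adapted k y.
Proof.
move=> [[Mc cx] [Es sx] [Ehs hsx]]; have [oc _ _ _ _] := charts_homeo Mc.
have H1 : \forall y \near x, cdom (nc_chart k) y by exact: open_nbhs_nbhs.
have H2 := near_fdom Es sx.
have H3 := @diffeo_continuous _ _ _ h x _ (near_fdom Ehs hsx).
by apply: filterS (filterI H1 (filterI H2 H3)) => y [? [? ?]]; split.
Qed.

Lemma nc_bundle_chart k p : adapted k (tag p) ->
  tcharts (nc_bundle k) /\ cdom (nc_bundle k) p.
Proof.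
move=> [[Mc cx] [Es sx] _]; split; last by split.
by exists (nc_chart k), (nc_frame k).
Qed.

Lemma bundle_cinvK c s p : charts M c -> frames E s -> cdom c (tag p) ->
  fdom s (tag p) -> cinv (bundle_chart c s) (cmap (bundle_chart c s) p) = p.
Proof.
case: p => x u Mc Es cx sx /=; rewrite row_mxKl row_mxKr cinvK//.
by rewrite -frame_sum.
Qed.

Lemma nc_cinvK k p : adapted k (tag p) ->
  cinv (nc_bundle k) (cmap (nc_bundle k) p) = p.
Proof. by move=> [[Mc cx] [Es sx] _]; exact: bundle_cinvK. Qed.

Lemma nc_image_cmap k p : adapted k (tag p) -> nc_image k (cmap (nc_bundle k) p).
Proof.
move=> kp; have [[Mc cx] [Es sx] _] := kp.
by split; rewrite /= row_mxKl ?cinvK//; exists (tag p).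
Qed.

Lemma nc_image_cinv k z : nc_image k z ->
  adapted k (tag (cinv (nc_bundle k) z)) /\
  cmap (nc_bundle k) (cinv (nc_bundle k) z) = z.
Proof.
move=> [Iz kz]; have [[Mc cx] [Es sx] _] := kz; split=> //=.
by have [_ ->] := image_cdom Mc Iz; rewrite fcoK// hsubmxK.
Qed.

Lemma near_lsubmx (z : 'rV[R]_(m + r)) (N : set 'rV[R]_m) :
  nbhs (lsubmx z) N -> \forall w \near z, N (lsubmx w).
Proof. by move=> H; have := @continuous_lsubmx R 1 m r z N H. Qed.

Lemma near_bundle_tag c s p (N : set M) : charts M c -> cdom c (tag p) ->
  nbhs (tag p) N ->
  \forall z \near cmap (bundle_chart c s) p, N (tag (cinv (bundle_chart c s) z)).
Proof.
move=> Mc cp /(near_cinv Mc cp) H.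
have {}H : nbhs (lsubmx (cmap (bundle_chart c s) p)) (fun z => N (cinv c z)).
  by rewrite /= row_mxKl; apply: filterS H => z [].
exact: near_lsubmx H.
Qed.

Lemma nc_image_open k : open (nc_image k).
Proof.
rewrite openE => z [Iz kz]; have [[Mc cx] _ _] := kz.
have [_ oI _ _ cI] := charts_homeo Mc.
have H1 : \forall w \near lsubmx z, (cmap (nc_chart k) @` cdom (nc_chart k)) w.
  by apply: open_nbhs_nbhs.
have H2 : \forall w \near lsubmx z, adapted k (cinv (nc_chart k) w).
  exact: (cI _ Iz _ (near_adapted kz)).
exact: (near_lsubmx (filterI H1 H2)).
Qed.

Lemma Ck_lsubmx n (U : set 'rV[R]_m) (f : 'rV[R]_m -> R^o) : open U ->
  Ck n U f -> Ck n ((@lsubmx R 1 m r) @^-1` U) (fun z => f (lsubmx z)).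
Proof.
move=> oU Cf; apply: (Ck_comp _ _ Cf) => //.
  by apply: open_comp => // z _; exact: continuous_lsubmx.
move=> j; rewrite (_ : (fun z => _) = fun z : 'rV[R]_(m + r) => z 0 (lshift r j)).
  exact: Ck_coord.
by apply/funext => z; rewrite mxE.
Qed.

Lemma smooth_near_tag p (f : M -> R^o) : smooth_near (charts M) (tag p) f ->
  smooth_near tcharts p (fun q => f (tag q)).
Proof.
move=> sf _ [c [s [Mc Es ->]]] [cp sp].
have [U [oU Up CU]] := sf c Mc cp.
exists (@lsubmx R 1 m r @^-1` U); split=> [||n].
- by apply: open_comp => // z _; exact: continuous_lsubmx.
- by rewrite /= row_mxKl.
- exact: (Ck_lsubmx (f := fun z => f (cinv c z))).
Qed.

(** In another bundle chart the fibre coordinates are linear combinations of the new ones, with the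
    transition functions as coefficients. *)
Lemma smooth_near_ycoord p s a : frames E s -> fdom s (tag p) ->
  smooth_near tcharts p (ycoord s a).
Proof.
move=> Es sp _ [c' [s' [Mc Es' ->]]] [cp s'p].
have H b : exists U, [/\ open U, U (cmap (bundle_chart c' s') p) & forall n, Ck n U
    (fun z => fco s (fvec s' b (tag (cinv (bundle_chart c' s') z))) 0 a : R^o)].
  apply: (smooth_near_tag (f := fun x => fco s (fvec s' b x) 0 a)) => //.
  - exact: frames_compat.
  - by exists c', s'.
have [U UP] := choice H.
have : \forall z \near cmap (bundle_chart c' s') p, (forall b, U b z) /\
    fdom s (tag (cinv (bundle_chart c' s') z)).
  apply: filterI; last by apply: near_bundle_tag => //; exact: near_fdom.
  near=> z => b; move: b; near: z; apply: filter_forall => b.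
  by have [oU Ub _] := UP b; exact: open_nbhs_nbhs.
move=> /nbhs_open[N [oN Np HN]]; exists N; split=> // n.
have := @Ck_sum R _ n N 'I_r (fun b z => z 0 (rshift m b) *
  fco s (fvec s' b (tag (cinv (bundle_chart c' s') z))) 0 a) oN.
have CN b : Ck n N (fun z => z 0 (rshift m b) *
  fco s (fvec s' b (tag (cinv (bundle_chart c' s') z))) 0 a).
  apply: Ck_mul => //; first exact: Ck_coord.
  by have [_ _ CU] := UP b; apply: Ck_sub (CU n) => z /HN[].
move=> /(_ CN); apply: Ck_ext => // z /HN[_ sz].
rewrite /ycoord /= fco_sum// summxE; apply: eq_bigr => b _.
by rewrite fcoZ// !mxE.
Unshelve. all: by end_near. Qed.

Lemma smooth_near_xcoord p c i : charts M c -> cdom c (tag p) ->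
  smooth_near tcharts p (fun q => cmap c (tag q) 0 i).
Proof.
by move=> Mc cp; apply: (smooth_near_tag (f := fun x => cmap c x 0 i)); exact: charts_compat.
Qed.

(** The type [tot E] has no topology of its own; neighbourhoods of [p] are replaced by preimages of
    neighbourhoods in [M]. *)
Lemma Ck_near_tot_ext n p f g (N : set M) : nbhs (tag p) N ->
  (forall q, N (tag q) -> f q = g q) -> Ck_near tcharts n p f -> Ck_near tcharts n p g.
Proof.
move=> Np fg sf _ [c [s [Mc Es ->]]] [cp sp].
have [U [oU Up CU]] := sf _ (ex_intro _ c (ex_intro _ s (And3 Mc Es erefl))) (conj cp sp).
have [V [oV Vp HV]] := nbhs_open (near_bundle_tag s Mc cp Np).
exists (U `&` V); split; [exact: openI|by split|].
apply: Ck_ext (Ck_sub _ CU); first exact: openI.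
  by move=> z [_ /HV /fg].
by move=> z [].
Qed.

Lemma pd_near_eq k p j f g (N : set M) : adapted k (tag p) -> nbhs (tag p) N ->
  (forall q, N (tag q) -> f q = g q) ->
  pd tcharts (nc_bundle k) p j f = pd tcharts (nc_bundle k) p j g.
Proof.
move=> kp Np fg; have [[Mc cp] _ _] := kp; rewrite /pd.
(* Both functions pass or fail the test in [pd] together, so the default value 0 is taken on both
   sides or on neither. *)
have -> : `[< Ck_near tcharts 1 p f >] = `[< Ck_near tcharts 1 p g >].
  apply: asbool_equiv_eq; split; first exact: Ck_near_tot_ext Np fg.
  by apply: Ck_near_tot_ext Np _ => q /fg.
case: ifP => // _; apply: near_eq_derive.
by apply: filterS (near_bundle_tag (nc_frame k) Mc cp Np) => z /fg.
Qed.

Lemma pdE k p j f : Ck_near tcharts 1 p f ->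
  pd tcharts (nc_bundle k) p j f =
  'D_(delta_mx 0 j) (fun z => f (cinv (nc_bundle k) z) : R^o) (cmap (nc_bundle k) p).
Proof. by move=> Cf; rewrite /pd asboolT. Qed.

Lemma Ck_near_nc_image k n f :
  (forall p, adapted k (tag p) -> Ck_near tcharts n p f) ->
  Ck n (nc_image k) (fun z => f (cinv (nc_bundle k) z)).
Proof.
move=> sf; apply: Ck_glue => z /nc_image_cinv[kz zE].
have [Tk kd] := nc_bundle_chart kz.
by have [U [oU Up CU]] := sf _ kz _ Tk kd; rewrite zE in Up; exists U.
Qed.

Lemma Ck_near_differentiable k p f : adapted k (tag p) -> Ck_near tcharts 1 p f ->
  differentiable (fun z => f (cinv (nc_bundle k) z) : R^o) (cmap (nc_bundle k) p).
Proof.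
move=> kp Cf; have [Tk kd] := nc_bundle_chart kp.
by have [U [_ Up [df _]]] := Cf _ Tk kd; exact: df.
Qed.

Lemma derive_ycoord k p a (v : 'rV[R]_(m + r)) : adapted k (tag p) ->
  'D_v (fun z => ycoord (nc_frame k) a (cinv (nc_bundle k) z) : R^o) (cmap (nc_bundle k) p) =
  v 0 (rshift m a).
Proof.
move=> kp; rewrite -(derive_coord (cmap (nc_bundle k) p)); apply: near_eq_derive.
apply: open_near_eq (@nc_image_open k) (nc_image_cmap kp) _ => z /nc_image_cinv[_ zE].
by rewrite -[in RHS]zE /= row_mxEr.
Qed.

Lemma derive_xcoord k p i (v : 'rV[R]_(m + r)) : adapted k (tag p) ->
  'D_v (fun z => cmap (nc_chart k) (tag (cinv (nc_bundle k) z)) 0 i : R^o)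
    (cmap (nc_bundle k) p) = v 0 (lshift r i).
Proof.
move=> kp; rewrite -(derive_coord (cmap (nc_bundle k) p)); apply: near_eq_derive.
apply: open_near_eq (@nc_image_open k) (nc_image_cmap kp) _ => z /nc_image_cinv[_ zE].
by rewrite -[in RHS]zE /= row_mxEl.
Qed.

Lemma dy_ycoord k p a b : adapted k (tag p) ->
  dy k p a (ycoord (nc_frame k) b) = (a == b)%:R.
Proof.
move=> kp; have [_ [Es sp] _] := kp.
rewrite /dy pdE; last exact/smooth_near_Ck/smooth_near_ycoord.
by rewrite derive_ycoord// mxE eqxx/= (inj_eq (@rshift_inj m r)) eq_sym.
Qed.

Lemma dx_ycoord k p i b : adapted k (tag p) ->
  dx k p i (ycoord (nc_frame k) b) = 0.
Proof.
move=> kp; have [_ [Es sp] _] := kp.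
rewrite /dx pdE; last exact/smooth_near_Ck/smooth_near_ycoord.
by rewrite derive_ycoord// mxE eqxx/= eq_rlshift.
Qed.

End BundleChart.

(** * Sections of the generalized tangent bundle in coordinates *)

Section Sections.
Context {R : realType} {m : nat} {M : manifold R m} {r : nat}.
Context {E : vbundle M r} {h eta : diffeo M} (A : gen_lie_algebroid E h eta).
Variable g : inv_morphism E h.
Implicit Types (k : natchart (E := E)) (p q : tot E) (f : tot E -> R^o).
Implicit Types (S : forall p : tot E, gtb h p).

Local Notation adapted := (adapted (h := h)).
Local Notation nc_image := (nc_image (h := h)).
Local Notation tcharts := (@tot_charts R m M r E).

Lemma gtb_sum2 p (I : finType) (F : I -> gtb h p) f :
  (\sum_i F i).2 f = \sum_i (F i).2 f.
Proof. by rewrite (big_morph (fun z : gtb h p => z.2 f) (id1 := 0) (op1 := +%R)). Qed.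

(* The components of the vector field [(S p).2] in the bundle chart of [k]. *)
Definition field_at k S p (j : 'I_(m + r)) : R :=
  match fintype.split j with
  | inl i => \sum_(b < r) hco k (S p) b * rho_co A k (tag p) i b
  | inr a => vco k (S p) a
  end.

Lemma field_at_l k S p i : field_at k S p (lshift r i) =
  \sum_(b < r) hco k (S p) b * rho_co A k (tag p) i b.
Proof. by rewrite /field_at (unsplitK (inl i)). Qed.

Lemma field_at_r k S p a : field_at k S p (rshift m a) = vco k (S p) a.
Proof. by rewrite /field_at (unsplitK (inr a)). Qed.

Lemma hbase2E k p a f : (hbase A k p a).2 f =
  \sum_(i < m) rho_co A k (tag p) i a * dx k p i f.
Proof. by rewrite /hbase/= fct_sumE. Qed.

Lemma in_gtb_pd k S p f : in_gtb A (S p) -> adapted k (tag p) ->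
  (S p).2 f = \sum_(j < m + r) field_at k S p j * pd tcharts (nc_bundle k) p j f.
Proof.
move=> /[apply] Sp; rewrite {1}Sp big_split_ord/=.
rewrite -[LHS]/((\sum_(a < r) hco k (S p) a *: hbase A k p a).2 f +
  (\sum_(a < r) vco k (S p) a *: vbase (h := h) k p a).2 f).
rewrite !gtb_sum2; congr (_ + _); last first.
  by apply: eq_bigr => a _; rewrite field_at_r.
transitivity (\sum_(a < r) \sum_(i < m)
    hco k (S p) a * (rho_co A k (tag p) i a * dx k p i f)).
  by apply: eq_bigr => a _; rewrite -mulr_sumr -hbase2E.
rewrite exchange_big/=; apply: eq_bigr => i _; rewrite field_at_l mulr_suml.
by apply: eq_bigr => a _; rewrite mulrA.
Qed.

Lemma in_gtb_near_eq S p f f' (N : set M) : in_gtb A (S p) -> nbhs (tag p) N ->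
  (forall q, N (tag q) -> f q = f' q) -> (S p).2 f = (S p).2 f'.
Proof.
move=> Sp Np ff; have [k kp] := @adapted_exists _ _ _ _ E h (tag p).
rewrite !(in_gtb_pd _ Sp kp); apply: eq_bigr => j _; congr (_ * _).
exact: pd_near_eq kp Np ff.
Qed.

Lemma in_gtb_derive k S p f : in_gtb A (S p) -> adapted k (tag p) ->
  Ck_near tcharts 1 p f -> (S p).2 f = \sum_(j < m + r) field_at k S p j *
   'D_(delta_mx 0 j) (fun z => f (cinv (nc_bundle k) z) : R^o) (cmap (nc_bundle k) p).
Proof.
move=> Sp kp Cf; rewrite (in_gtb_pd _ Sp kp); apply: eq_bigr => j _.
by rewrite pdE.
Qed.

Lemma in_gtb_xcoord k S p i : in_gtb A (S p) -> adapted k (tag p) ->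
  (S p).2 (fun q => cmap (nc_chart k) (tag q) 0 i) =
  \sum_(b < r) hco k (S p) b * rho_co A k (tag p) i b.
Proof.
move=> Sp kp; have [[Mc cp] _ _] := kp.
rewrite (in_gtb_derive Sp kp); last exact/smooth_near_Ck/smooth_near_xcoord.
rewrite (bigD1 (lshift r i))// big1 => [|j /andP[_ ji]].
  rewrite -[LHS]/(_ + 0 : R) addr0.
  by rewrite (derive_xcoord _ _ kp) mxE !eqxx mulr1 field_at_l.
by rewrite (derive_xcoord _ _ kp) mxE eqxx/= eq_sym (negPf ji) mulr0.
Qed.

(** The regularity that allows the field of a section to be integrated by [ode_exists] and to be
    applied repeatedly to functions along its integral curves. *)
Lemma Ck_field k S n j : gtb_section A S ->
  Ck n (nc_image k) (fun z => field_at k S (cinv (nc_bundle k) z) j).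
Proof.
move=> [_ sS]; rewrite /field_at; case: (fintype.split j) => [i|a].
- apply: (@Ck_sum _ _ n _ _ (fun b z => hco k (S (cinv (nc_bundle k) z)) b *
    rho_co A k (tag (cinv (nc_bundle k) z)) i b)); first exact: nc_image_open.
  move=> b; apply: (Ck_mul (f := fun z => hco k (S (cinv (nc_bundle k) z)) b)
    (g := fun z => rho_co A k (tag (cinv (nc_bundle k) z)) i b)).
  + exact: nc_image_open.
  + apply: (Ck_near_nc_image (f := fun q => hco k (S q) b)) => p kp.
    by apply: smooth_near_Ck; have [] := sS k p kp b.
  + apply: (Ck_near_nc_image (f := fun q => rho_co A k (tag q) i b)) => p kp.
    apply: smooth_near_Ck; apply: (smooth_near_tag (f := fun x => rho_co A k x i b)).
    exact: rho_smooth.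
- apply: (Ck_near_nc_image (f := fun q => vco k (S q) a)) => p kp.
  by apply: smooth_near_Ck; have [] := sS k p kp a.
Qed.

Lemma vco_liouville k p a : adapted k (tag p) ->
  vco k (liouville (h := h) k p) a = ycoord (nc_frame k) a p.
Proof.
move=> kp; rewrite /vco /liouville gtb_sum2 (bigD1 a)//= big1 ?addr0 => [|b ba].
  rewrite -[LHS]/(ycoord (nc_frame k) a p * dy k p a (ycoord (nc_frame k) a)).
  by rewrite (dy_ycoord _ _ kp) eqxx mulr1.
rewrite -[LHS]/(ycoord (nc_frame k) b p * dy k p b (ycoord (nc_frame k) a)).
by rewrite (dy_ycoord _ _ kp) (negPf ba) mulr0.
Qed.

Lemma liouville2E k p f : (liouville (h := h) k p).2 f =
  \sum_(a < r) ycoord (nc_frame k) a p * dy k p a f.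
Proof. by rewrite /liouville gtb_sum2. Qed.

Lemma g_co_inv k x : adapted k x ->
  (\matrix_(b < r, a < r) ginv_co g k x b a) *m
  (\matrix_(b < r, a < r) g_co g k x b a) = 1%:M :> 'M[R]_r.
Proof.
move=> [_ [Es sx] [Ehs hsx]]; apply/matrixP => b a; rewrite !mxE.
rewrite eq_sym -(fco_fvec a b Es sx) -(im_funK g (fvec (nc_frame k) a x)).
rewrite [in RHS](frame_sum (g x (fvec (nc_frame k) a x)) Ehs hsx) linear_sum fco_sum// summxE.
by apply: eq_bigr => c _; rewrite linearZ fcoZ// !mxE mulrC.
Qed.

(* [J S = C] says that the inverse matrix of [g] maps the horizontal
   components of [S] to the fibre coordinates. *)
Lemma semispray_hco k S p b : semispray A g S -> adapted k (tag p) ->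
  hco k (S p) b = \sum_(a < r) g_co g k (tag p) b a * ycoord (nc_frame k) a p.
Proof.
move=> [_ JS] kp; have GG := g_co_inv kp.
set G := \matrix_(_, _) g_co _ _ _ _ _ in GG.
set G' := \matrix_(_, _) ginv_co _ _ _ _ _ in GG.
pose H : 'cV[R]_r := \col_a hco k (S p) a.
pose Y : 'cV[R]_r := \col_a ycoord (nc_frame k) a p.
have GH : G' *m H = Y.
  apply/colP => c; rewrite !mxE -(vco_liouville c kp) -JS// /Jop /vco gtb_sum2.
  apply: eq_bigr => a _; rewrite !mxE.
  rewrite -[RHS]/(hco k (S p) a * (\sum_(b < r) ginv_co g k (tag p) b a *: vbase (h := h) k p b).2
    (ycoord (nc_frame k) c)).
  rewrite mulrC gtb_sum2; congr (_ * _); rewrite (bigD1 c)//= big1 ?addr0 => [|d dc].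
    rewrite -[RHS]/(ginv_co g k (tag p) c a * dy k p c (ycoord (nc_frame k) c)).
    by rewrite (dy_ycoord _ _ kp) eqxx mulr1.
  rewrite -[LHS]/(ginv_co g k (tag p) d a * dy k p d (ycoord (nc_frame k) c)).
  by rewrite (dy_ycoord _ _ kp) (negPf dc) mulr0.
have : H = G *m Y by rewrite -GH mulmxA (mulmx1C GG) mul1mx.
move=> /(congr1 (fun N : 'cV[R]_r => N b 0)); rewrite !mxE => ->.
by apply: eq_bigr => a _; rewrite !mxE.
Qed.

(* The vertical part of [[C, S] - S = 0] is Euler's identity for functions that
   are homogeneous of degree 2. *)
Lemma spray_euler k S p c : spray A g S -> adapted k (tag p) ->
  \sum_(a < r) ycoord (nc_frame k) a p * dy k p a (fun q => vco k (S q) c) =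
  2 * vco k (S p) c.
Proof.
move=> [[[inS _] _] _ brS] kp; have Sp := inS p.
have := congr1 (fun z : gtb h p => z.2 (ycoord (nc_frame k) c)) (brS k p kp).
rewrite -[X in X = _ -> _]/((gtb_br A k (liouville k) S p).2 (ycoord (nc_frame k) c)
  - vco k (S p) c).
rewrite -[X in _ = X -> _]/(0 : R) => /eqP; rewrite subr_eq0 => /eqP.
pose hs := fun b : 'I_r => (liouville (h := h) k p).2 (fun q => hco k (S q) b)
  - (S p).2 (fun q => hco k (liouville (h := h) k q) b) +
  \sum_(a < r) \sum_(d < r) L_co A k (tag p) a d b * hco k (liouville (h := h) k p) a *
    hco k (S p) d.
pose vs := fun b : 'I_r => (liouville (h := h) k p).2 (fun q => vco k (S q) b)
  - (S p).2 (fun q => vco k (liouville (h := h) k q) b).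
rewrite -[X in X = _ -> _]/((\sum_(b < r) hs b *: hbase A k p b).2 (ycoord (nc_frame k) c)
  + (\sum_(b < r) vs b *: vbase (h := h) k p b).2 (ycoord (nc_frame k) c)).
rewrite !gtb_sum2 big1 ?add0r => [|b _]; last first.
  rewrite -[LHS]/(hs b * (hbase A k p b).2 (ycoord (nc_frame k) c)) hbase2E.
  by rewrite big1 ?mulr0// => i _; rewrite (dx_ycoord _ _ kp) mulr0.
rewrite (bigD1 c)//= big1 ?addr0 => [|b bc]; last first.
  rewrite -[LHS]/(vs b * dy k p b (ycoord (nc_frame k) c)).
  by rewrite (dy_ycoord _ _ kp) (negPf bc) mulr0.
rewrite -[X in X = _ -> _]/(vs c * dy k p c (ycoord (nc_frame k) c)) (dy_ycoord _ _ kp).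
rewrite eqxx mulr1 /vs liouville2E => /eqP; rewrite subr_eq => /eqP ->.
(* The vertical components of the Liouville section are the fibre coordinates, so [(S p).2] sends
   the [c]-th one to [V^c]. Together with the [V^c] coming from [- S] this makes the factor 2. *)
rewrite (in_gtb_near_eq (f' := ycoord (nc_frame k) c) Sp (near_adapted kp)).
  by rewrite -[(S p).2 _]/(vco k (S p) c) mulr2n mulrDl mul1r.
by move=> q kq; exact: vco_liouville.
Qed.

End Sections.

(** * Euler identities *)

Section Euler.
Context {R : realType}.

(** The quotient [f u / u ^ 2] has derivative 0 for [u > 0], hence is constant there. *)
Lemma euler_homogeneous2 (f df : R -> R) (l : R) : 0 < l ->
  (forall t : R, 0 < t -> is_derive t 1 f (df t)) ->
  (forall t, 0 < t -> t * df t = 2 * f t) -> f l = l ^+ 2 * f 1.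
Proof.
move=> l0 fd E.
have gd (t : R) : 0 < t -> is_derive t 1 (fun u => f u * u^-1 ^+ 2) 0.
  move=> t0; have ne : t != 0 by rewrite gt_eqF.
  have di : is_derive t 1 (fun u : R => u^-1) (- t^-1 ^+ 2).
    have := is_deriveV ne (is_derive_id t (1:R)).
    by rewrite [_ *: 1]mulr1 exprVn.
  have := is_deriveM (fd t t0) (is_deriveX 2 di).
  have -> : (fun u => f u * u^-1 ^+ 2) = f * (fun u : R => u^-1) ^+ 2.
    by apply/funext => u; rewrite !fctE.
  move=> H; apply: is_derive_eq H _; rewrite !fctE /GRing.scale/=.
  have -> : df t = 2 * f t / t by rewrite -E// mulrAC divff// mul1r.
  by field.
have cst a b : 0 < a -> a <= b -> f b * b^-1 ^+ 2 = f a * a^-1 ^+ 2.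
  move=> a0 ab; apply/eqP; rewrite -subr_eq0 -normr_le0.
  have := @mvt_bound R (fun u => f u * u^-1 ^+ 2) (fun=> 0) a b 0 ab.
  rewrite mul0r; apply=> t /andP[at_ _]; last by rewrite normr0.
  exact/gd/(lt_le_trans a0).
have ne : l != 0 by rewrite gt_eqF.
have : f l * l^-1 ^+ 2 = f 1.
  have -> : f 1 = f 1 * 1^-1 ^+ 2 by rewrite invr1 expr1n mulr1.
  by have [l1|/ltW l1] := leP 1 l; [exact: cst|apply/esym; exact: cst].
by move=> <-; field.
Qed.

(* As [t] tends to 0, [df t = 2 * f t / t] tends to both [df 0] and [2 * df 0]. *)
Lemma euler_homogeneous2_derive0 (f df : R -> R) : is_derive (0 : R) 1 f (df 0) ->
  {for (0 : R), continuous df} -> (forall t, t * df t = 2 * f t) -> df 0 = 0.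
Proof.
move=> /is_derive1_caratheodory[g [fg cg g0]] cdf E.
have f0 : f 0 = 0.
  by have := E 0; rewrite mul0r => /esym/eqP; rewrite mulf_eq0 pnatr_eq0/= => /eqP.
have H z : z != 0 -> df z = 2 * g z.
  move=> z0; apply: (mulfI z0); rewrite E; have := fg z.
  by rewrite f0 !subr0 => ->; ring.
have c1 : (df z - 2 * g z) @[z --> 0^'] --> df 0 - 2 * g 0.
  apply/continuous_withinNx; apply: continuousB => //.
  by apply: continuousM => //; exact: cst_continuous.
have c2 : (df z - 2 * g z) @[z --> (0:R)^'] --> (0:R).
  apply: cvg_near_cst; near=> z; rewrite H ?subrr//.
  by near: z; exact: nbhs_dnbhs_neq.
have : df 0 - 2 * g 0 = 0 :> R by exact: (cvg_unique (@norm_hausdorff _ _) c1 c2).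
by rewrite g0; lra.
Unshelve. all: by end_near. Qed.

Section Divergence.
Context {m r : nat}.
Variable W : set 'rV[R]_(m + r).
Hypothesis oW : open W.
Variables (Q : 'I_r -> 'rV[R]_(m + r) -> R^o) (F : 'rV[R]_(m + r) -> R^o).
Hypothesis CQ : forall k a, Ck k W (Q a).
Hypothesis QF : forall z a, W z -> Q a z = F z * z 0 (rshift m a).

Local Notation ddy a f z := ('D_(delta_mx 0 (rshift m a)) (f : 'rV[R]_(m + r) -> R^o) z).

Lemma rsubmx_neq0 (z : 'rV[R]_(m + r)) : rsubmx z != 0 ->
  exists a, z 0 (rshift m a) != 0.
Proof.
move=> z0; apply/existsP; apply: contraR z0; rewrite negb_exists => /forallP H.
by apply/eqP/rowP => a; rewrite !mxE; apply/eqP; rewrite -[_ == _]negbK.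
Qed.

Lemma derive_factor z a b : W z -> differentiable F z ->
  ddy b (Q a) z = ddy b F z * z 0 (rshift m a) + F z * (a == b)%:R.
Proof.
move=> Wz dF.
have E1 : \forall w \near z, (F * (fun w : 'rV[R]_(m + r) => w 0 (rshift m a) : R^o)) w = Q a w.
  by apply: (open_near_eq oW Wz) => w Ww; rewrite QF.
rewrite -(near_eq_derive _ E1) deriveM; last 2 first.
- exact: diff_derivable.
- exact/diff_derivable/differentiable_coord.
rewrite derive_coord mxE eqxx/= (inj_eq (@rshift_inj m r)) addrC.
by congr (_ + _); rewrite [LHS]mulrC.
Qed.

(** Origin of the constant: by the product rule the divergence of [F y] is [r F] plus the radial
    derivative of [F], and the latter is [F]. *)
Lemma divergence_factor z : W z -> differentiable F z ->
  \sum_(a < r) z 0 (rshift m a) * ddy a F z = F z ->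
  \sum_(a < r) ddy a (Q a) z = (r%:R + 1) * F z.
Proof.
move=> Wz dF E; under eq_bigr => a _ do rewrite derive_factor// eqxx mulr1 mulrC.
by rewrite big_split/= E sumr_const card_ord -mulr_natl; ring.
Qed.

(** Differentiating [Q a = F * y^a] radially gives the radial derivative of [F] times [y^a], plus
    [F * y^a], and this equals [2 * F * y^a]. A nonzero coordinate [y^a] can be cancelled. *)
Lemma euler_factor z : W z -> differentiable F z -> rsubmx z != 0 ->
  (forall a, \sum_(b < r) z 0 (rshift m b) * ddy b (Q a) z = 2 * Q a z) ->
  \sum_(a < r) z 0 (rshift m a) * ddy a F z = F z.
Proof.
move=> Wz dF z0 E.
have [a za] := rsubmx_neq0 z0.
apply: (mulIf za); have := E a; rewrite QF//.
under eq_bigr => b _ do rewrite derive_factor// mulrDr.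
rewrite big_split/= [X in _ + X](bigD1 a)//= [X in _ + (_ + X)]big1 ?addr0 => [|b ba].
  rewrite eqxx mulr1 mulr_suml => H.
  have -> : \sum_(i < r) z 0 (rshift m i) * ddy i F z * z 0 (rshift m a) =
     \sum_(i < r) z 0 (rshift m i) * (ddy i F z * z 0 (rshift m a)).
    by apply: eq_bigr => b _; rewrite mulrA.
  by lra.
by rewrite eq_sym (negPf ba) !mulr0.
Qed.

Hypothesis cylW : forall z (y : 'rV[R]_r), W z -> W (row_mx (lsubmx z) y).
Hypothesis eulerQ : forall z a, W z ->
  \sum_(b < r) z 0 (rshift m b) * ddy b (Q a) z = 2 * Q a z.
Hypothesis F0 : forall z, W z -> rsubmx z = 0 -> F z = 0.

(** Each summand vanishes. On the ray from the null vector in direction [a], Euler's identity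
    becomes [t * df t = 2 * f t], which forces [df 0 = 0]. The assumption [cylW] keeps the ray
    inside [W]. *)
Lemma divergence_null z : W z -> rsubmx z = 0 -> \sum_(a < r) ddy a (Q a) z = 0.
Proof.
move=> Wz z0; apply: big1 => a _.
pose ray (t : R) := row_mx (lsubmx z) (t *: (delta_mx 0 a : 'rV[R]_r)).
have Wray t : W (ray t) by exact: cylW.
have ray0 : ray 0 = z by rewrite /ray scale0r -z0 hsubmxK.
have dray (t : R) j : is_derive t 1 (fun u => ray u 0 j : R^o) ((delta_mx 0 (rshift m a) : 'rV[R]_(m + r)) 0 j).
  have -> : (fun u => ray u 0 j : R^o) =
      fun u => z 0 j * (j != rshift m a)%:R + u * (delta_mx 0 (rshift m a) : 'rV[R]_(m + r)) 0 j.
    apply/funext => u; rewrite /ray; case: (split_ordP j) => i ->.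
      by rewrite row_mxEl !mxE eqxx/= eq_lrshift mulr1 mulr0 addr0.
    rewrite row_mxEr !mxE eqxx/= (inj_eq (@rshift_inj m r)).
    have := congr1 (fun N : 'rV[R]_r => N 0 i) z0; rewrite !mxE => ->.
    by rewrite mul0r add0r.
  exact: is_derive_affine.
have dQ w : W w -> differentiable (Q a) w by have [+ _] := CQ 1 a; exact.
have := @euler_homogeneous2_derive0 (fun t => Q a (ray t)) (fun t => ddy a (Q a) (ray t)).
rewrite ray0; apply.
- have := chain_curve (dray 0) (dQ _ (Wray 0)).
  rewrite (bigD1 (rshift m a))//= big1 ?addr0 => [|j ja]; first by rewrite mxE !eqxx mul1r ray0.
  by rewrite mxE (negPf ja) andbF mul0r.
- have cD : {for ray 0, continuous (fun w => ddy a (Q a) w)}.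
    by have [_ DQ] := CQ 1 a; exact: DQ.
  apply: continuous_comp cD; apply: continuous_rV => j.
  exact: is_derive_continuous (dray 0 j).
- move=> t; rewrite -(eulerQ a (Wray t)) (bigD1 a)//= big1 ?addr0 => [|b ba].
    by rewrite row_mxEr !mxE !eqxx mulr1.
  by rewrite row_mxEr !mxE (negPf ba) andbF mulr0 mul0r.
Qed.

(* Where [y <> 0], [F = Q a / y a] is differentiable and Euler's identity for [Q]
   descends to [F]; on the null section both sides vanish. *)
Lemma factor_divergence z : W z ->
  F z = (r%:R + 1)^-1 * \sum_(a < r) ddy a (Q a) z.
Proof.
move=> Wz; have r1 : r%:R + 1 != 0 :> R by rewrite natr1 pnatr_eq0.
have [z0|z0] := eqVneq (rsubmx z) 0.
  by rewrite divergence_null// mulr0 F0.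
suff [dF E] : differentiable F z /\ \sum_(a < r) z 0 (rshift m a) * ddy a F z = F z.
  by rewrite (divergence_factor Wz dF E) mulKf.
have [a za] := rsubmx_neq0 z0.
suff dF : differentiable F z by split=> //; apply: euler_factor => // b; exact: eulerQ.
have dQ w : W w -> differentiable (Q a) w by have [+ _] := CQ 1 a; exact.
have dz : differentiable (fun w : 'rV[R]_(m + r) => (w 0 (rshift m a))^-1 : R^o) z.
  by apply: differentiableV => //; exact: differentiable_coord.
apply: near_eq_differentiable (differentiableM (dQ z Wz) dz).
have nz : \forall w \near z, (w : 'rV[R]_(m + r)) 0 (rshift m a) != 0.
  have N0 : nbhs (z 0 (rshift m a)) [set x : R | x != 0].
    by apply: open_nbhs_nbhs; split=> //; exact: open_neq.
  exact: (@coord_continuous R 1 (m + r) 0 (rshift m a) z _ N0).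
have nW : \forall w \near z, W w by exact: open_nbhs_nbhs.
by apply: filterS2 nz nW => w w0 Ww; rewrite !fctE QF// mulfK.
Qed.

End Divergence.
End Euler.

(** * Changes of parameter *)

Section Reparametrization.
Context {R : realType}.
Implicit Types (I : set R) (f g : R -> R).

Lemma derivable_is_derive f (t : R) : derivable f t 1 ->
  is_derive t 1 f (derive1 f t).
Proof. by rewrite derive1E; exact: derivableP. Qed.

Lemma is_derive_unique f (t a b : R) :
  is_derive t 1 f a -> is_derive t 1 f b -> a = b.
Proof. by move=> [_ <-] [_ <-]. Qed.

(** Peels off the innermost derivative, where [derive1n] adds an outermost one; inductions on [n]
    can then generalize over [f]. *)
Fixpoint diffn (n : nat) I f : Prop :=
  match n with
  | 0 => True
  | n'.+1 => (forall t : R, I t -> derivable f t 1) /\ diffn n' I (derive1 f)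
  end.

Lemma diffn_derive1n I f : (forall n, diffn n I f) ->
  forall n (t : R), I t -> derivable (derive1n n f) t 1.
Proof.
move=> H n t It; elim: n f H => [|n IH] f H; first by have [+ _] := H 1%N; exact.
by rewrite derive1Sn; apply: IH => k; have [] := H k.+1.
Qed.

Lemma diffn_ext n I f g : open I -> (forall t, I t -> f t = g t) ->
  diffn n I f -> diffn n I g.
Proof.
move=> oI; elim: n f g => //= n IH f g fg [df Df]; split=> [t It|].
  exact: near_eq_derivable (open_near_eq oI It fg) (df t It).
apply: IH Df => t It; rewrite !derive1E; apply: near_eq_derive.
exact: (open_near_eq oI It).
Qed.

Lemma diffn_glue n I f :
  (forall t, I t -> exists J, [/\ open J, J t & diffn n J f]) -> diffn n I f.
Proof.
elim: n f => // n IH f H; split=> [t /H[J [_ Jt [df _]]]|]; first exact: df.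
by apply: IH => t /H[J [oJ Jt [_ Df]]]; exists J.
Qed.

Lemma diffn_pred n I f : diffn n.+1 I f -> diffn n I f.
Proof.
elim: n f => // n IH f [df Df]; split=> //; exact: IH.
Qed.

Lemma diffn_add n I f g : open I -> diffn n I f -> diffn n I g ->
  diffn n I (fun t => f t + g t).
Proof.
move=> oI; elim: n f g => //= n IH f g [df Df] [dg Dg]; split=> [t It|].
  exact: (derivableD (df t It) (dg t It)).
apply: diffn_ext (IH _ _ Df Dg) => // t It.
by rewrite !derive1E [RHS]deriveD//; [exact: df|exact: dg].
Qed.

Lemma diffn_mul n I f g : open I -> diffn n I f -> diffn n I g ->
  diffn n I (fun t => f t * g t).
Proof.
move=> oI; elim: n f g => // n IH f g Ff Fg; have [df Df] := Ff; have [dg Dg] := Fg.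
split=> [t It|]; first exact: (derivableM (df t It) (dg t It)).
apply: diffn_ext (diffn_add oI (IH _ _ (diffn_pred Ff) Dg) (IH _ _ (diffn_pred Fg) Df)) => // t It.
by rewrite !derive1E [RHS]deriveM//; [exact: df|exact: dg].
Qed.

Lemma diffn_cst n I (a : R) : diffn n I (fun=> a).
Proof.
elim: n a => //= n IH a; split=> [t _|]; first exact: derivable_cst.
have -> : derive1 (fun=> a) = (fun=> 0) by apply/funext => t; exact: derive1_cst.
exact: IH.
Qed.

(** Along an integral curve of [X] the derivative of [f] is the function [X f] along the same curve,
    and [X f] is smooth again. *)
Lemma diffn_along_curve d (W : set 'rV[R]_d) (X : 'I_d -> 'rV[R]_d -> R^o)
    (z : R -> 'rV[R]_d) I n (f : 'rV[R]_d -> R^o) : open W -> open I ->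
  (forall k j, Ck k W (X j)) ->
  (forall t : R, I t -> W (z t) /\ forall j,
     is_derive t 1 (fun u => z u 0 j : R^o) (X j (z t))) ->
  (forall k, Ck k W f) -> diffn n I (fun t => f (z t)).
Proof.
move=> oW oI CX dz; elim: n f => //= n IH f Cf.
have df t : I t -> is_derive t (1:R) (fun u => f (z u) : R^o)
    (\sum_(j < d) X j (z t) * 'D_(delta_mx 0 j) f (z t)).
  move=> /dz[Wz dzt]; apply: chain_curve dzt _.
  by have [+ _] := Cf 1%N; exact.
split=> [t /df[]//|].
have := IH (fun w => \sum_(j < d) X j w * 'D_(delta_mx 0 j) f w).
have H k : Ck k W (fun w => \sum_(j < d) X j w * 'D_(delta_mx 0 j) f w).
  apply: (@Ck_sum _ _ k _ _ (fun j w => X j w * 'D_(delta_mx 0 j) f w)) => // j.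
  by apply: Ck_mul => //; have [_] := Cf k.+1; exact.
move=> /(_ H); apply: diffn_ext => // t It.
by rewrite derive1E; apply/esym; apply: (@derive_val _ _ _ _ _ _ _ (df t It)).
Qed.

Lemma is_derive_increasing I f (df : R -> R) : is_interval I ->
  (forall t : R, I t -> is_derive t 1 f (df t)) -> (forall t, I t -> 0 < df t) ->
  forall t u, I t -> I u -> t < u -> f t < f u.
Proof.
move=> iI dfE df0 t u It Iu tu.
have Itu x : t <= x <= u -> I x by exact: (iI _ _ It Iu).
have [||c ctu E] := @MVT R f df t u tu.
- by move=> x /[!in_itv]/= /andP[h1 h2]; apply/dfE/Itu; rewrite !ltW.
- apply: continuous_in_subspaceT => x /set_mem/=; rewrite in_itv/= => xtu.
  exact: is_derive_continuous (dfE x (Itu x xtu)).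
rewrite -subr_gt0 E mulr_gt0 ?subr_gt0// df0//; apply: Itu.
by move: ctu; rewrite in_itv/= => /andP[h1 h2]; rewrite !ltW.
Qed.

Lemma inverse_parameter I f (df : R -> R) : open I -> is_interval I ->
  (forall t : R, I t -> is_derive t 1 f (df t)) -> (forall t, I t -> 0 < df t) ->
  exists tau : R -> R, [/\ open (f @` I), is_interval (f @` I) &
    forall t : R, I t -> tau (f t) = t /\ is_derive (f t) 1 tau (df t)^-1].
Proof.
move=> oI iI dfE df0; have incr := is_derive_increasing iI dfE df0.
(* Inverse of [f] on the image of [I]; elsewhere the value 0 is arbitrary. *)
pose tau x := xget 0 [set t | I t /\ f t = x].
have tauK t : I t -> tau (f t) = t.
  move=> It; rewrite /tau; case: xgetP => [u _ [Iu fu]|/(_ t)]; last by case.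
  have [ut|tu|//] := ltgtP u t.
  - by have := incr u t Iu It ut; rewrite fu ltxx.
  - by have := incr t u It Iu tu; rewrite fu ltxx.
have cf t : I t -> \forall u \near t, {for u, continuous f}.
  move=> It; apply: filterS (open_nbhs_nbhs (conj oI It)) => u Iu.
  exact: is_derive_continuous (dfE u Iu).
have nK t : I t -> {near t, cancel f tau}.
  by move=> It; apply: filterS (open_nbhs_nbhs (conj oI It)) => u Iu; exact: tauK.
exists tau; split=> [||t It]; last first.
- split; first exact: tauK.
  by apply: is_derive_inverse => //; [exact: nK|exact: cf|exact: dfE|rewrite gt_eqF ?df0].
- move=> _ _ [t It <-] [u Iu <-] x /andP[tx xu].
  have tu : t <= u.
    rewrite leNgt; apply/negP => ut; have := incr u t Iu It ut.
    by rewrite ltNge (le_trans tx xu).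
  have [||c ctu <-] := @IVT R f t u x tu.
  + apply: continuous_in_subspaceT => y /set_mem/=; rewrite in_itv/= => /(iI _ _ It Iu) Iy.
    exact: is_derive_continuous (dfE y Iy).
  + by rewrite ge_min tx le_max xu orbT.
  + by exists c => //; apply: (iI _ _ It Iu); move: ctu; rewrite in_itv.
(* Openness of the image: for [x] near [f t], continuity puts [tau x] in [I], and
   [f (tau x) = x]. *)
- rewrite openE => _ [t It <-].
  have H1 := near_continuous_can_sym (cf t It) (nK t It).
  have H2 : \forall x \near f t, I (tau x).
    have c := nbhs_singleton (near_can_continuous (nK t It) (cf t It)).
    by apply: c; rewrite tauK//; exact: open_nbhs_nbhs.
  by apply: filterS2 H1 H2 => x fx Ix; exists (tau x).
Qed.

Lemma solve_parameter I (th : R -> R) : open I -> is_interval I ->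
  (forall n, diffn n I th) ->
  exists s e : R -> R, [/\ param_change I s,
    forall t : R, I t -> is_derive t 1 s (e t),
    forall t, 0 < e t &
    forall t : R, I t -> is_derive t 1 e (- th t * e t)].
Proof.
(* A primitive needs a base point, so the empty interval is treated apart. *)
move=> oI iI dth; have [[t0 It0]|nI] := pselect (exists t, I t); last first.
  have nI' t : ~ I t by move=> It; apply: nI; exists t.
  exists id, (fun=> 1); split=> [|t /nI'//|t|t /nI'//]; last exact: ltr01.
  by split=> [n t /nI'//|t /nI'//|t u /set_mem/nI'].
have cth t : I t -> {for t, continuous th}.
  move=> It; have [+ _] := dth 1%N => /(_ t It)/derivable1_diffP.
  exact: differentiable_continuous.
have [P [_ dP]] := primitive oI iI It0 cth.
pose e (t : R) : R := expR (- P t).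
have e0 t : 0 < e t by exact: expR_gt0.
have de t : I t -> is_derive t (1:R) e (- th t * e t).
  move=> It; have := @is_derive1_comp R expR (fun u => - P u) t _ _ (is_derive_expR _)
    (is_deriveN (dP t It)).
  by rewrite mulrC.
have ce t : I t -> {for t, continuous e} by move=> /de; exact: is_derive_continuous.
have [s [_ ds]] := primitive oI iI It0 ce.
(* The equation [e' = - th * e] gains one derivative at each step. *)
have de1 n : diffn n I e.
  elim: n => [|n IH]; first by [].
  split=> [t It|]; first by case: (de t It).
  apply: diffn_ext (diffn_mul oI (diffn_mul oI (diffn_cst n I (-1)) (dth n)) IH) => // t It.
  by rewrite derive1E mulN1r (@derive_val _ _ _ _ _ _ _ (de t It)).
have s1 t : I t -> e t = derive1 s t.
  by move=> It; rewrite derive1E; apply/esym; apply: (@derive_val _ _ _ _ _ _ _ (ds t It)).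
exists s, e; split; [|exact: ds|exact: e0|exact: de]; split.
- apply: diffn_derive1n => -[//|n]; split=> [t /ds[]//|].
  exact: diffn_ext (de1 n).
- by move=> t It; rewrite -s1.
- move=> t u /set_mem It /set_mem Iu.
  by apply: (is_derive_increasing iI ds) => // v _; exact: e0.
Qed.

End Reparametrization.

(** * Geodesics of a spray *)

Section SprayGeodesics.
Context {R : realType} {m : nat} {M : manifold R m} {r : nat}.
Context {E : vbundle M r} {h eta : diffeo M} (A : gen_lie_algebroid E h eta).
Variable g : inv_morphism E h.
Implicit Types (k : natchart (E := E)) (p q : tot E) (f : tot E -> R^o).
Implicit Types (S : forall p : tot E, gtb h p) (Sys : mech_system A).

Local Notation adapted := (adapted (h := h)).
Local Notation nc_image := (nc_image (h := h)).
Local Notation tcharts := (@tot_charts R m M r E).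

Lemma ycoord_tscale k l p a : adapted k (tag p) ->
  ycoord (nc_frame k) a (tscale l p) = l * ycoord (nc_frame k) a p.
Proof. by move=> [_ [Es sp] _]; rewrite /ycoord /= fcoZ// mxE. Qed.

Lemma tscaleA l1 l2 p : tscale l1 (tscale l2 p) = tscale (l1 * l2) p.
Proof. by rewrite /tscale /= scalerA. Qed.

Lemma tscale1 p : tscale 1 p = p.
Proof. by case: p => x u; rewrite /tscale /= scale1r. Qed.

Lemma cmap_xcoord k p i : cmap (nc_bundle k) p 0 (lshift r i) = cmap (nc_chart k) (tag p) 0 i.
Proof. exact: row_mxEl. Qed.

Lemma cmap_ycoord k p a : cmap (nc_bundle k) p 0 (rshift m a) = ycoord (nc_frame k) a p.
Proof. exact: row_mxEr. Qed.

(** Integrates Euler's identity along the ray through [p]. The base point stays fixed, so one chart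
    serves for the whole ray. *)
Lemma spray_tscale S k p l a : spray A g S -> adapted k (tag p) -> 0 < l ->
  vco k (S (tscale l p)) a = l ^+ 2 * vco k (S p) a.
Proof.
move=> hS kp l0; have [[[inS sS] _] _ _] := hS.
pose V q := vco k (S q) a.
have CV q : adapted k (tag q) -> Ck_near tcharts 1 q V.
  by move=> kq; apply: smooth_near_Ck; have [] := sS k q kq a.
pose dV t := \sum_(b < r) ycoord (nc_frame k) b p * dy k (tscale t p) b V.
rewrite -[LHS]/(V (tscale l p)) -[vco k (S p) a]/(V p) -[in RHS](tscale1 p).
apply: (@euler_homogeneous2 R (fun t => V (tscale t p)) dV l l0) => [t _|t _].
  have kt : adapted k (tag (tscale t p)) by [].
  pose w j := (row_mx 0 (fco (nc_frame k) (tagged p)) : 'rV[R]_(m + r)) 0 j.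
  have dz j : is_derive t (1:R) (fun u => cmap (nc_bundle k) (tscale u p) 0 j : R^o) (w j).
    have -> : (fun u => cmap (nc_bundle k) (tscale u p) 0 j : R^o) =
        fun u => cmap (nc_bundle k) (tscale 0 p) 0 j + u * w j.
      apply/funext => u; rewrite /w; case: (split_ordP j) => i ->.
        by rewrite !cmap_xcoord row_mxEl mxE mulr0 addr0.
      by rewrite !cmap_ycoord !ycoord_tscale// row_mxEr mul0r add0r.
    exact: is_derive_affine.
  have := chain_curve dz (Ck_near_differentiable kt (CV _ kt)).
  move=> H; apply: is_derive_eq (near_eq_is_derive _ H) _.
    by apply: filterE => u; rewrite (nc_cinvK (h := h)).
  rewrite big_split_ord -[LHS]/(_ + _ : R) [X in X + _]big1 => [|i _]; last first.
    by rewrite /w row_mxEl mxE mul0r.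
  rewrite add0r; apply: eq_bigr => b _; rewrite /w row_mxEr /dy pdE//; exact: CV.
have := spray_euler a hS (kp : adapted k (tag (tscale t p))).
rewrite -/V => <-; rewrite /dV mulr_sumr; apply: eq_bigr => b _.
by rewrite ycoord_tscale// mulrA.
Qed.

(** Being adapted depends only on the base point [eta (h (c t))], which is continuous in [t] because
    [c] is. *)
Lemma open_adapted_curve k (I : set R) (cd : R -> tot E) (c : R -> M) :
  open I -> differentiable_curve I c -> over_curve (h := h) (eta := eta) I c cd ->
  open [set t | I t /\ adapted k (tag (cd t))].
Proof.
move=> oI dc oc; rewrite openE => t [It kt].
have nI : \forall u \near t, I u by exact: open_nbhs_nbhs.
have [ct _] := dc t It.
have cE : {for t, continuous (fun u => eta (h (c u)))}.
  apply: continuous_comp; first by apply: continuous_comp => //; exact: diffeo_continuous.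
  exact: diffeo_continuous.
have := near_adapted kt; rewrite oc// => /cE H.
by apply: filterS2 nI H => u Iu ku; split=> //; rewrite oc.
Qed.

Lemma semispray_rho k S p i : semispray A g S -> adapted k (tag p) ->
  \sum_(b < r) hco k (S p) b * rho_co A k (tag p) i b =
  \sum_(b < r) \sum_(a < r) rho_co A k (tag p) i b * g_co g k (tag p) b a *
    ycoord (nc_frame k) a p.
Proof.
move=> hS kp; apply: eq_bigr => b _; rewrite (semispray_hco b hS kp) mulr_suml.
by apply: eq_bigr => a _; rewrite mulrC mulrA.
Qed.

(** By the definition of [G_co], [G^a - F^a / 4] is [- V^a / 2]. *)
Lemma geodesic_ycoord k Sys S (I : set R) c cd (t : R) a :
  geodesic g Sys S I c cd -> I t -> adapted k (tag (cd t)) ->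
  is_derive t 1 (fun u => ycoord (nc_frame k) a (cd u) : R^o) (vco k (S (cd t)) a).
Proof.
move=> [_ _ _ _ geo] It kt; have [dya yaE] := geo t It k kt a.
have -> : vco k (S (cd t)) a = derive1 (fun u => ycoord (nc_frame k) a (cd u) : R^o) t.
  by move: yaE; rewrite /G_co; lra.
exact: derivable_is_derive.
Qed.

Lemma geodesic_field k Sys S (I : set R) c cd (t : R) :
  semispray A g S -> geodesic g Sys S I c cd -> I t -> adapted k (tag (cd t)) ->
  forall j, is_derive t 1 (fun u => cmap (nc_bundle k) (cd u) 0 j : R^o)
    (field_at A k S (cd t) j).
Proof.
move=> hS geo It kt j; have [[oI iI] dc oc lift _] := geo; case: (split_ordP j) => i ->.
  have := lift t It k; rewrite -oc// => /(_ kt i)[dxi xiE].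
  rewrite field_at_l.
  have -> : \sum_(b < r) hco k (S (cd t)) b * rho_co A k (tag (cd t)) i b =
      derive1 (fun u => cmap (nc_chart k) (eta (h (c u))) 0 i : R^o) t.
    by rewrite -xiE semispray_rho.
  have d1 : is_derive t (1:R) (fun u => cmap (nc_chart k) (eta (h (c u))) 0 i : R^o)
      (derive1 (fun u => cmap (nc_chart k) (eta (h (c u))) 0 i : R^o) t).
    exact: derivable_is_derive.
  apply: near_eq_is_derive d1; apply: (open_near_eq oI It) => u Iu.
  by rewrite cmap_xcoord oc.
rewrite field_at_r; apply: near_eq_is_derive (geodesic_ycoord i geo It kt).
by apply: filterE => u; rewrite cmap_ycoord.
Qed.

Lemma integral_curve_derive k S (cd : R -> tot E) (t : R) f :
  in_gtb A (S (cd t)) -> adapted k (tag (cd t)) ->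
  (\forall u \near t, adapted k (tag (cd u))) -> Ck_near tcharts 1 (cd t) f ->
  (forall j, is_derive t 1 (fun u => cmap (nc_bundle k) (cd u) 0 j : R^o)
    (field_at A k S (cd t) j)) ->
  is_derive t 1 (fun u => f (cd u)) ((S (cd t)).2 f).
Proof.
move=> inS kt nk Cf dz; rewrite (in_gtb_derive inS kt Cf).
apply: near_eq_is_derive (chain_curve dz (Ck_near_differentiable kt Cf)).
by apply: filterS nk => u ku; rewrite (nc_cinvK (h := h)).
Qed.

Lemma geodesic_exists Sys S p : semispray A g S ->
  exists (I : set R) c cd, [/\ geodesic g Sys S I c cd, I 0 & cd 0 = p].
Proof.
move=> hS; have [[inS sS] _] := hS; have gS : gtb_section A S by split.
have [k kp] := @adapted_exists _ _ _ _ E h (tag p).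
pose X j z := field_at A k S (cinv (nc_bundle k) z) j : R^o.
have CX j : Ck 1 (nc_image k) (X j) by exact: Ck_field.
have [a [w [a0 w0 Hw]]] := ode_exists (@nc_image_open _ _ _ _ _ h k) (nc_image_cmap kp) CX.
pose I : set R := [set` `]- a, a[].
pose cd t := cinv (nc_bundle k) (w t).
(* The lift must lie over [eta o h o c], which determines [c]. *)
pose c t := diffeo_inv h (diffeo_inv eta (tag (cd t))).
have oI : open I by exact: interval_open.
have Ia t : I t -> `|t| <= a.
  by rewrite /I/= in_itv/= ler_norml => /andP[h1 h2]; rewrite !ltW.
have Wt t : I t -> nc_image k (w t) by move=> /Ia/Hw[].
have kt t : I t -> adapted k (tag (cd t)) by move=> /Wt/nc_image_cinv[].
have etac t : eta (h (c t)) = tag (cd t) by rewrite /c !diffeo_invK.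
have dz t j : I t -> is_derive t (1:R) (fun u => cmap (nc_bundle k) (cd u) 0 j : R^o)
    (field_at A k S (cd t) j).
  move=> It; have [_ /(_ j)] := Hw t (Ia t It).
  apply: near_eq_is_derive; apply: (open_near_eq oI It) => u /Wt/nc_image_cinv[_ zE].
  by rewrite /cd zE.
(* Although obtained in the chart of [k], this holds for every C^1 function; applied to the
   coordinates of any other chart it gives the equations there. *)
have df t f : I t -> Ck_near tcharts 1 (cd t) f ->
    is_derive t (1:R) (fun u => f (cd u) : R^o) ((S (cd t)).2 f).
  move=> It Cf; apply: integral_curve_derive (kt t It) _ Cf _ => //.
    by apply: filterS (open_nbhs_nbhs (conj oI It)) => u; exact: kt.
  by move=> j; exact: dz.
exists I, c, cd; split; last first.
- by rewrite /cd w0 (nc_cinvK (h := h)).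
- by rewrite /I/= in_itv/= oppr_lt0 a0.
split.
- by split=> //; exact: interval_is_interval.
- move=> t It; split=> [|d Md dct i].
    have [[Mc _] _ _] := kt t It.
    have [_ _ _ _ cI] := charts_homeo Mc.
    have cw : {for t, continuous w}.
      apply: continuous_rV => j; have [_ /(_ j)] := Hw t (Ia t It).
      exact: is_derive_continuous.
    have ctag : {for t, continuous (fun u => tag (cd u))}.
      apply: (continuous_comp (g := cinv (nc_chart k))); last by apply: cI; case: (Wt t It).
      by apply: continuous_comp cw _; exact: continuous_lsubmx.
    apply: continuous_comp; last exact: diffeo_inv_continuous.
    by apply: continuous_comp ctag _; exact: diffeo_inv_continuous.
  pose F (x : M) : R^o := cmap d (diffeo_inv h (diffeo_inv eta x)) 0 i.
  have sF : smooth_near (charts M) (tag (cd t)) F.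
    apply: (smooth_near_comp (f := fun y => cmap d (diffeo_inv h y) 0 i)
      (@diffeo_inv_smooth _ _ _ eta)).
    apply: (smooth_near_comp (f := fun y => cmap d y 0 i) (@diffeo_inv_smooth _ _ _ h)).
    exact: charts_compat.
  by have [] := df t (fun q => F (tag q)) It (smooth_near_Ck 1 (smooth_near_tag sF)).
- by move=> t _; rewrite etac.
- move=> t It k' k't i; rewrite etac in k't *.
  have [[Mc c't] _ _] := k't.
  have sx := smooth_near_xcoord i Mc c't.
  have [d1 d2] := df t _ It (smooth_near_Ck 1 sx).
  have -> : (fun u => cmap (nc_chart k') (eta (h (c u))) 0 i : R^o) =
      (fun u => cmap (nc_chart k') (tag (cd u)) 0 i : R^o).
    by apply/funext => u; rewrite etac.
  by split=> //; rewrite derive1E d2 (in_gtb_xcoord _ (inS _) k't) semispray_rho.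
- move=> t It k' k't b; have [_ [Es s't] _] := k't.
  have sy := smooth_near_ycoord b Es s't.
  have [d1 d2] := df t _ It (smooth_near_Ck 1 sy).
  split=> //; rewrite derive1E d2 -/(vco k' (S (cd t)) b) /G_co; lra.
Qed.

(* Differentiating [y (u) = s' (u) * y' (s u)] at a point gives
   [V = (s'' / s') y + V'], with a factor that does not depend on the chart. *)
Lemma reparam_factor Sys S Sys' S' p : spray A g S -> spray A g S' ->
  geodesics_reparam g Sys S Sys' S' ->
  exists l : R, forall k, adapted k (tag p) -> forall a,
    vco k (S' p) a - vco k (S p) a = l * ycoord (nc_frame k) a p.
Proof.
move=> hS hS' rep; have [sS _ _] := hS; have [sS' _ _] := hS'.
have [I [c [cd [geo I0 cd0]]]] := geodesic_exists Sys p sS.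
have [s [c' [cd' [[ds ds0 _] geo' cE]]]] := rep I c cd geo.
have [[oI iI] dc oc _ _] := geo.
have d1 : is_derive (0:R) (1:R) s (derive1 s 0).
  by apply: derivable_is_derive; exact: (ds 0%N 0 I0).
have d2 : is_derive (0:R) (1:R) (derive1 s) (derive1 (derive1 s) 0).
  by apply: derivable_is_derive; exact: (ds 1%N 0 I0).
have s0 := ds0 0 I0; have [_ cdE] := cE 0 I0.
exists (- (derive1 (derive1 s) 0 / derive1 s 0)) => k; rewrite -{1}cd0 => kp a.
have kp' : adapted k (tag (cd' (s 0))) by move: kp; rewrite cdE.
have I's0 : (s @` I) (s 0) by exists 0.
have dy' := geodesic_ycoord a geo' I's0 kp'.
have dy := geodesic_ycoord a geo I0 kp.
have dys := @is_derive1_comp R (fun u => ycoord (nc_frame k) a (cd' u)) s 0 _ _ dy' d1.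
have H := is_deriveM d2 dys.
have : vco k (S (cd 0)) a = derive1 s 0 * (vco k (S' (cd' (s 0))) a * derive1 s 0) +
    ycoord (nc_frame k) a (cd' (s 0)) * derive1 (derive1 s) 0.
  apply: (is_derive_unique dy); apply: near_eq_is_derive H.
  have nI := open_adapted_curve (k := k) oI dc oc.
  apply: filterS (open_nbhs_nbhs (conj nI (conj I0 kp))) => u [Iu ku].
  have [_ cdu] := cE u Iu; rewrite !fctE [in RHS]cdu ycoord_tscale//.
  by move: ku; rewrite cdu.
have := spray_tscale a hS' kp' s0; rewrite -cdE.
have := ycoord_tscale (derive1 s 0) a kp'; rewrite -cdE cd0 => -> -> ->.
by field; rewrite gt_eqF.
Qed.

End SprayGeodesics.

(** * Projective changes and reparametrized geodesics *)

Section ProjectiveChange.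
Context {R : realType} {m : nat} {M : manifold R m} {r : nat}.
Context {E : vbundle M r} {h eta : diffeo M} (A : gen_lie_algebroid E h eta).
Variable g : inv_morphism E h.
Implicit Types (k : natchart (E := E)) (p q : tot E).
Variables (S S' : forall p : tot E, gtb h p).
Hypothesis (hS : spray A g S) (hS' : spray A g S').

Local Notation adapted := (adapted (h := h)).
Local Notation nc_image := (nc_image (h := h)).
Local Notation tcharts := (@tot_charts R m M r E).

Definition vdiff k a (z : 'rV[R]_(m + r)) : R^o :=
  vco k (S' (cinv (nc_bundle k) z)) a - vco k (S (cinv (nc_bundle k) z)) a.

Lemma Ck_vco (Z : forall p, gtb h p) k n a : spray A g Z ->
  Ck n (nc_image k) (fun z => vco k (Z (cinv (nc_bundle k) z)) a).
Proof.
move=> [[[_ sZ] _] _ _]; apply: (Ck_near_nc_image (f := fun q => vco k (Z q) a)) => p kp.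
by apply: smooth_near_Ck; have [] := sZ k p kp a.
Qed.

Lemma Ck_vdiff k n a : Ck n (nc_image k) (vdiff k a).
Proof.
have oI := @nc_image_open _ _ _ _ _ h k.
apply: Ck_ext (Ck_add oI (Ck_vco k n a hS') (Ck_scale (-1) oI (Ck_vco k n a hS))) => // z _.
by rewrite mulN1r.
Qed.

Lemma vco_euler (Z : forall p, gtb h p) k a z : spray A g Z -> nc_image k z ->
  \sum_(b < r) z 0 (rshift m b) * 'D_(delta_mx 0 (rshift m b))
    (fun w => vco k (Z (cinv (nc_bundle k) w)) a : R^o) z =
  2 * vco k (Z (cinv (nc_bundle k) z)) a.
Proof.
move=> hZ /nc_image_cinv[kz zE]; rewrite -(spray_euler a hZ kz).
apply: eq_bigr => b _; rewrite -cmap_ycoord zE /dy pdE ?zE//.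
have [[[_ sZ] _] _ _] := hZ.
by apply: smooth_near_Ck; have [] := sZ k _ kz a.
Qed.

Lemma vdiff_euler k a z : nc_image k z ->
  \sum_(b < r) z 0 (rshift m b) * 'D_(delta_mx 0 (rshift m b)) (vdiff k a) z =
  2 * vdiff k a z.
Proof.
move=> Wz; rewrite /vdiff mulrBr -!vco_euler// -sumrB; apply: eq_bigr => b _.
rewrite -mulrBr; congr (_ * _); apply: deriveB; apply: diff_derivable.
- by have [+ _] := Ck_vco k 1 a hS'; exact.
- by have [+ _] := Ck_vco k 1 a hS; exact.
Qed.

Lemma nc_image_cylinder k z (y : 'rV[R]_r) : nc_image k z ->
  nc_image k (row_mx (lsubmx z) y).
Proof. by move=> [Iz kz]; split; rewrite row_mxKl. Qed.

Lemma Ck_vdivergence k n (c : R) : Ck n (nc_image k) (fun z =>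
  c * \sum_(a < r) 'D_(delta_mx 0 (rshift m a)) (vdiff k a) z).
Proof.
have oI := @nc_image_open _ _ _ _ _ h k.
apply: Ck_scale => //.
apply: (@Ck_sum _ _ n _ _ (fun a z => 'D_(delta_mx 0 (rshift m a)) (vdiff k a) z)) => // a.
by have [_] := Ck_vdiff k n.+1 a; exact.
Qed.

Lemma projective_of_factor :
  (forall p, exists l : R, forall k, adapted k (tag p) -> forall a,
    vco k (S' p) a - vco k (S p) a = l * ycoord (nc_frame k) a p) ->
  projectively_related S S'.
Proof.
move=> fac.
(* On the null section any scalar satisfies the relation; it is normalized to 0, as
   [factor_divergence] demands. *)
have /choice[f fP] : forall p, exists l : R, (tagged p = 0 -> l = 0) /\
    forall k, adapted k (tag p) -> forall a,
    vco k (S' p) a - vco k (S p) a = l * ycoord (nc_frame k) a p.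
  move=> p; have [l lP] := fac p; have [p0|p0] := pselect (tagged p = 0); last by exists l.
  exists 0; split=> // k kp a; have [_ [Es sp] _] := kp.
  by rewrite lP// /ycoord p0 fco0// mxE !mulr0.
pose F k z : R^o := f (cinv (nc_bundle k) z).
have QF k z a : nc_image k z -> vdiff k a z = F k z * z 0 (rshift m a).
  by move=> /nc_image_cinv[kz zE]; rewrite /vdiff (fP _).2// -cmap_ycoord zE.
have F0 k z : nc_image k z -> rsubmx z = 0 -> F k z = 0.
  move=> _ z0; apply: (fP _).1; rewrite /= z0.
  by apply: big1 => a _; rewrite mxE scale0r.
have FE k z : nc_image k z -> F k z = (r%:R + 1)^-1 *
    \sum_(a < r) 'D_(delta_mx 0 (rshift m a)) (vdiff k a) z.
  apply: (factor_divergence (@nc_image_open _ _ _ _ _ h k) (Ck_vdiff k) (@QF k)) => //.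
  - by move=> w y; exact: nc_image_cylinder.
  - by move=> w a; exact: vdiff_euler.
  - exact: F0.
have CF k n : Ck n (nc_image k) (F k).
  apply: Ck_ext (Ck_vdivergence k n (r%:R + 1)^-1); first exact: nc_image_open.
  by move=> z /FE.
have Cf p : Ck_near tcharts 1 p (f : tot E -> R^o).
  move=> _ [c [s [Mc Es ->]]] [cp sp]; have [s' Es' s'p] := frames_cover E (h (tag p)).
  pose k := NatChart c s s'.
  have kp : adapted k (tag p) by [].
  exists (nc_image k); split; [exact: nc_image_open|exact: nc_image_cmap|exact: CF].
exists f; split=> // [k p kp|k p kp].
- pose z := cmap (nc_bundle k) p; have Wz := nc_image_cmap kp.
  have zE : F k z = f p by rewrite /F (nc_cinvK (h := h)).
  have -> : \sum_(a < r) ycoord (nc_frame k) a p * dy k p a f =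
      \sum_(a < r) z 0 (rshift m a) * 'D_(delta_mx 0 (rshift m a)) (F k) z.
    by apply: eq_bigr => a _; rewrite -cmap_ycoord /dy pdE.
  have [z0|z0] := eqVneq (rsubmx z) 0.
    rewrite -zE F0// big1// => a _.
    by have := congr1 (fun N : 'rV[R]_r => N 0 a) z0; rewrite !mxE => ->; rewrite mul0r.
  rewrite -zE; apply: (euler_factor (@nc_image_open _ _ _ _ _ h k) (@QF k)) => //.
    by have [+ _] := CF k 1%N; exact.
  by move=> a; exact: vdiff_euler.
- have [[[inS _] _] _ _] := hS; have [[[inS' _] _] _ _] := hS'.
  have [sS _ _] := hS; have [sS' _ _] := hS'.
  (* The horizontal parts agree, since [g] and [y] determine them. *)
  rewrite (inS' p k kp) [in RHS](inS p k kp) -addrA; congr (_ + _).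
    by apply: eq_bigr => a _; rewrite (semispray_hco a sS kp) (semispray_hco a sS' kp).
  rewrite /liouville scaler_sumr -big_split/=; apply: eq_bigr => a _.
  by rewrite scalerA -scalerDl -(fP p).2// addrC subrK.
Qed.

Lemma projective_vco (f : tot E -> R^o) k p a : adapted k (tag p) ->
  S' p = S p + f p *: liouville k p ->
  vco k (S' p) a = vco k (S p) a + f p * ycoord (nc_frame k) a p.
Proof.
move=> kp ->; rewrite -(vco_liouville a kp).
by [].
Qed.

(** The identity of [divergence_factor] differentiates [f] only once, while its other side is built
    from the smooth components of [S] and [S']. *)
Lemma projective_factor_smooth (f : tot E -> R^o) k n :
  (forall p, Ck_near tcharts 1 p f) -> homogeneous1 (h := h) f ->
  (forall k p, adapted k (tag p) -> S' p = S p + f p *: liouville k p) ->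
  Ck n (nc_image k) (fun z => f (cinv (nc_bundle k) z)).
Proof.
move=> Cf hf SS'.
have oI := @nc_image_open _ _ _ _ _ h k.
apply: Ck_ext (Ck_vdivergence k n (r%:R + 1)^-1) => // z Wz.
have [kz zE] := nc_image_cinv Wz.
have df : differentiable (fun z => f (cinv (nc_bundle k) z) : R^o) z.
  by have := Ck_near_differentiable kz (Cf _); rewrite zE.
have QF w a : nc_image k w -> vdiff k a w = f (cinv (nc_bundle k) w) * w 0 (rshift m a).
  move=> /nc_image_cinv[kw wE]; rewrite /vdiff (projective_vco a kw (SS' k _ kw)).
  by rewrite -cmap_ycoord wE addrC addrA addNr add0r.
rewrite (divergence_factor oI QF Wz df); last first.
  rewrite -(hf k _ kz); apply: eq_bigr => a _; rewrite -cmap_ycoord /dy pdE ?zE//.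
by rewrite mulKf// natr1 pnatr_eq0.
Qed.

Lemma projective_reparam Sys Sys' : projectively_related S S' ->
  geodesics_reparam (A := A) g Sys S Sys' S'.
Proof.
move=> [f [Cf hf SS']] I c cd geo; have [[oI iI] dc oc lift _] := geo.
have [sS _ _] := hS; have gS := sS.1.
have Cff k n := @projective_factor_smooth f k n Cf hf SS'.
have dth n : diffn n I (fun t => f (cd t)).
  apply: diffn_glue => t It; have [k kt] := @adapted_exists _ _ _ _ E h (tag (cd t)).
  exists [set u | I u /\ adapted k (tag (cd u))]; split=> //.
    exact: open_adapted_curve oI dc oc.
  have oJ := open_adapted_curve (k := k) oI dc oc.
  apply: (diffn_ext (f := fun u => f (cinv (nc_bundle k) (cmap (nc_bundle k) (cd u)))) oJ).
    by move=> u [_ ku]; rewrite (nc_cinvK (h := h)).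
  apply: (@diffn_along_curve R (m + r) (nc_image k)
    (fun j z => field_at A k S (cinv (nc_bundle k) z) j)
    (fun u => cmap (nc_bundle k) (cd u)) [set u | I u /\ adapted k (tag (cd u))] n
    (fun z => f (cinv (nc_bundle k) z)) (@nc_image_open _ _ _ _ _ h k) oJ) => [i j|u [Iu ku]|i].
  - exact: Ck_field.
  - split; first exact: nc_image_cmap.
    by move=> j; rewrite (nc_cinvK (h := h))//; exact: (geodesic_field sS geo).
  - exact: Cff.
have [s [e [ps ds e0 de]]] := solve_parameter oI iI dth.
have [tau [oI' iI' tauP]] := inverse_parameter oI iI ds (fun t _ => e0 t).
have s1 t : I t -> derive1 s t = e t.
  by move=> It; rewrite derive1E (@derive_val _ _ _ _ _ _ _ (ds t It)).
have ct t : I t -> {for s t, continuous tau}.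
  by move=> /tauP[_]; exact: is_derive_continuous.
(* Forced by the required relation between the lifts, [s'] being [e]. *)
pose cd' x := tscale (e (tau x))^-1 (cd (tau x)).
have comp (F : R -> R) d t : I t -> is_derive t (1:R) F d ->
    is_derive (s t) (1:R) (fun x => F (tau x)) (d * (e t)^-1).
  move=> It dF; have [tt dt] := tauP t It.
  by apply: (@is_derive1_comp R F tau (s t)); rewrite ?tt.
exists s, (fun x => c (tau x)), cd'; split=> //; last first.
  move=> t It; have [tt _] := tauP t It; rewrite /cd' tt; split=> //.
  by rewrite tscaleA s1// divff ?tscale1// gt_eqF.
split=> //.
- move=> _ [t It <-]; have [tt _] := tauP t It; have [cc dcc] := dc t It; split.
    by apply: continuous_comp; [exact: ct|rewrite tt].
  move=> d Md; rewrite tt => cdt i.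
  by have [] := comp _ _ t It (derivable_is_derive (dcc d Md cdt i)).
- by move=> _ [t It <-]; have [tt _] := tauP t It; rewrite /= tt; exact: oc.
- move=> _ [t It <-] k; have [tt _] := tauP t It; rewrite tt => kt i.
  have [dxi xiE] := lift t It k kt i.
  have kct : adapted k (tag (cd t)) by rewrite oc.
  have [d1 d2] := comp _ _ t It (derivable_is_derive dxi).
  split=> //; rewrite derive1E d2 -xiE mulr_suml; apply: eq_bigr => b _.
  rewrite mulr_suml; apply: eq_bigr => a _; rewrite /cd' tt (ycoord_tscale _ _ kct).
  by rewrite mulrCA mulrC.
- move=> _ [t It <-] k; have [tt _] := tauP t It; rewrite /cd' /= tt => kt a.
  pose ya u : R := ycoord (nc_frame k) a (tscale (e (tau u))^-1 (cd (tau u))).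
  have dy := geodesic_ycoord a geo It kt.
  have ne : e t != 0 by rewrite gt_eqF.
  have dw := is_deriveM (is_deriveV ne (de t It)) dy.
  have nJ : \forall x \near s t, adapted k (tag (cd (tau x))).
    have oJ := open_adapted_curve (k := k) oI dc oc.
    have Jt : nbhs (tau (s t)) [set u | I u /\ adapted k (tag (cd u))].
      by rewrite tt; apply: open_nbhs_nbhs.
    have nI : \forall x \near s t, I (tau x) /\ adapted k (tag (cd (tau x))) := ct t It _ Jt.
    by apply: filterS nI => x [].
  (* With [e' = - f e], the derivative of [y / e] in [t] is [(V + f y) / e]. Passing to the
     parameter [s] divides once more by [e], and [V' / e^2] is the value of [V'] at the rescaled
     lift by 2-homogeneity. *)
  have dya : is_derive (s t) (1:R) ya (vco k (S' (tscale (e t)^-1 (cd t))) a).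
    apply: near_eq_is_derive (is_derive_eq (comp _ _ t It dw) _).
      by apply: filterS nJ => x kx; rewrite /ya (ycoord_tscale _ _ kx).
    rewrite (spray_tscale a hS' kt) ?invr_gt0//.
    rewrite (projective_vco a kt (SS' k _ kt)) /GRing.scale/=; field.
    exact: ne.
  split; first by case: dya.
  have : derive1 ya (s t) = vco k (S' (tscale (e t)^-1 (cd t))) a.
    by rewrite derive1E (@derive_val _ _ _ _ _ _ _ dya).
  by rewrite /ya /G_co => ->; lra.
Qed.

End ProjectiveChange.

Theorem theorem5p14 (R : realType) (m r : nat) (M : manifold R m)
    (E : vbundle M r) (h eta : diffeo M) (A : gen_lie_algebroid E h eta)
    (g : inv_morphism E h) (Sys Sys' : mech_system A)
    (S S' : forall p : tot E, gtb h p)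
    (hS : spray A g S) (hS' : spray A g S') :
  projectively_related S S' <->
  geodesics_differ_by_param g Sys S Sys' S'.
Proof.
split=> [pS|[rep _]].
  split; apply: projective_reparam => //; have [f [_ _ SS']] := pS.
  (* Symmetry of the relation: [- f] relates [S'] to [S] at each point, and its regularity and
     homogeneity are recovered by the same argument. *)
  apply: (projective_of_factor hS' hS) => p; exists (- f p) => k kp a.
  by rewrite (projective_vco a kp (SS' k p kp)) opprD addrA subrr add0r mulNr.
apply: (projective_of_factor hS hS') => p; exact: reparam_factor rep.
Qed.
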